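(* Let $p,q\in(0,\infty]$, let $k,n\in\mathbb{N}$ be fixed, and for each $m\in\mathbb{N}$ let $X=(X_{i,j})_{i\le m,j\le n}$ be uniformly distributed on $\mathbb{B}_{p,q}^{m,n}$, with $R_i:=\lVert(X_{i,j})_{j\le n}\rVert_q$ for $i\le m$. Let $\xi_1,\dots,\xi_k$ be independent $\frac pn$-Gaussian random variables, and let $\Theta_1,\dots,\Theta_k$ be independent random vectors, independent of $(\xi_1,\dots,\xi_k)$, each distributed according to the cone measure on $\mathbb{S}_q^{n-1}$. (a) As $m\to\infty$, $$(m^{1/p}X_{i,j})_{i\le k,j\le n}\longrightarrow(|\xi_i|^{1/n}\Theta_i)_{i\le k}\quad\text{in distribution}.$$ (b) As $m\to\infty$, the empirical measures satisfy $$\frac1m\sum_{i=1}^m\delta_{m^{1/p}R_i}\longrightarrow\mathcal{L}(|\xi_1|^{1/n})\quad\text{and}\quad\frac1m\sum_{i=1}^m\delta_{m^{1/p}(X_{i,j})_{j\le n}}\longrightarrow\mathcal{L}(|\xi_1|^{1/n}\Theta_1)$$ in probability, where convergence is understood as convergence in probability in the space of probability measures on $\mathbb{R}$, respectively $\mathbb{R}^n$, endowed with the Lévy–Prokhorov metric.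
   Context: For $p\in(0,\infty]$, $\lVert x\rVert_p=(\sum_{i}|x_i|^p)^{1/p}$ if $p<\infty$ and $\lVert x\rVert_\infty=\max_i|x_i|$ on $\mathbb{R}^n$; $\mathbb{B}_p^n$, $\mathbb{S}_p^{n-1}$ are the unit ball and unit sphere, $\omega_p^n$ is the volume of $\mathbb{B}_p^n$. For $x\in\mathbb{R}^{m\times n}$, $\lVert x\rVert_{p,q}:=\bigl\lVert\bigl(\lVert(x_{i,j})_{j\le n}\rVert_q\bigr)_{i\le m}\bigr\rVert_p$ and $\mathbb{B}_{p,q}^{m,n}:=\{x\in\mathbb{R}^{m\times n}:\lVert x\rVert_{p,q}\le1\}$. The cone measure on $\mathbb{S}_q^{n-1}$ is $\kappa_q^{n-1}(A):=\mathrm{vol}_n(\{sa:s\in[0,1],a\in A\})/\omega_q^n$ for Borel $A\subset\mathbb{S}_q^{n-1}$. The $p$-Gaussian distribution has Lebesgue density $\frac{1}{2p^{1/p}\Gamma(1/p+1)}e^{-|x|^p/p}$ on $\mathbb{R}$ if $p<\infty$, and $\frac12\mathbf{1}_{[-1,1]}(x)$ if $p=\infty$. Conventions for $p=\infty$: $1/p:=0$, $p/n:=\infty$. $\mathcal{L}(Y)$ is the law of $Y$; $\delta_x$ is the Dirac measure at $x$. In (a), $m\ge k$ is understood. *)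

(* Defs.v *)
(* R^(m x n) is 'M[R]_(m, n) and R^n is 'rV[R]_n. *)
From HB Require Import structures.
From mathcomp Require Import all_boot all_order all_algebra.
From mathcomp Require Import all_classical all_reals all_analysis.

Set Implicit Arguments.
Unset Strict Implicit.
Unset Printing Implicit Defensive.

Import Order.TTheory GRing.Theory Num.Theory.
Import numFieldNormedType.Exports.

Local Open Scope classical_set_scope.
Local Open Scope ring_scope.

(* Borel sigma-algebra of R^(m x n). *)
HB.instance Definition _ (R : realType) (m n : nat) :=
  @isMeasurable.Build (sigma_display (@open 'M[R]_(m, n))) 'M[R]_(m, n)
    <<s @open 'M[R]_(m, n) >> (@sigma_algebra0 _ setT _) (@sigma_algebraC _ _)
    (@sigma_algebra_bigcup _ setT _).

(* 1/p, with 1/p = 0 for p = +oo. *)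
Definition recip (R : realType) (p : \bar R) : R := fine (p^-1)%E.

(* Used for 0 < p only: the second branch is p = +oo, and the starting value 0
   of the maximum is harmless since the entries are nonnegative. *)
Definition pnorm (R : realType) (p : \bar R) n (x : 'rV[R]_n) : R :=
  if p is r%:E then (\sum_(i < n) `|x 0 i| `^ r) `^ r^-1
  else \big[Num.max/0]_(i < n) `|x 0 i|.

Definition pqnorm (R : realType) (p q : \bar R) m n (x : 'M[R]_(m, n)) : R :=
  pnorm p (\row_(i < m) pnorm q (row i x)).

Definition pball (R : realType) (p : \bar R) n : set 'rV[R]_n :=
  [set x | pnorm p x <= 1].

Definition psphere (R : realType) (p : \bar R) n : set 'rV[R]_n :=
  [set x | pnorm p x = 1].

Definition pqball (R : realType) (p q : \bar R) m n : set 'M[R]_(m, n) :=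
  [set x | pqnorm p q x <= 1].

Arguments pball {R} p n.
Arguments psphere {R} p n.
Arguments pqball {R} p q m n.

(* n-fold product of the Lebesgue measure of R, transported along
   (t, v) |-> (t, v_0, ..., v_(n-1)). *)
Fixpoint vol_row (R : realType) n : set 'rV[R]_n -> \bar R :=
  match n with
  | 0 => fun A => \d_(0 : 'rV[R]_0) A
  | n'.+1 => fun A : set 'rV[R]_(1 + n') =>
      (@lebesgue_measure R \x @vol_row R n')%E
        [set z : R * 'rV[R]_n' | A (row_mx z.1%:M z.2)]
  end.

Definition vol_mx (R : realType) m n (A : set 'M[R]_(m, n)) : \bar R :=
  vol_row [set v : 'rV[R]_(m * n) | A (vec_mx v)].

Definition uniform_law (R : realType) m n (B A : set 'M[R]_(m, n)) : \bar R :=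
  (vol_mx (A `&` B) / vol_mx B)%E.

(* The cone measure, extended by 0 outside the sphere. *)
Definition cone_measure (R : realType) (q : \bar R) n (A : set 'rV[R]_n) :
    \bar R :=
  (vol_row [set x | exists (s : R) a,
                      [/\ 0 <= s <= 1, (A `&` psphere q n) a & x = s *: a]%R]
   / vol_row (pball q n))%E.

Arguments cone_measure {R} q n A.

Definition Gamma (R : realType) (s : R) : R :=
  \int[@lebesgue_measure R]_(t in `]0, +oo[) (t `^ (s - 1) * expR (- t)).

Definition pgaussian_pdf (R : realType) (p : \bar R) (x : R) : R :=
  if p is r%:E then
    (2 * r `^ r^-1 * Gamma (r^-1 + 1))^-1 * expR (- (`|x| `^ r / r))
  else 2^-1 * \1_`[(-1), 1] x.

Definition pgaussian (R : realType) (p : \bar R) (A : set R) : \bar R :=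
  (\int[@lebesgue_measure R]_(x in A) (pgaussian_pdf p x)%:E)%E.

Definition has_law (R : realType) d (T : measurableType d) (P : probability T R)
    d' (S : measurableType d') (Y : {RV P >-> S}) (mu : set S -> \bar R) : Prop :=
  forall A, measurable A -> distribution P Y A = mu A.

(* Intersections over subfamilies are covered by taking A i = setT. *)
Definition independent_family (R : realType) d (T : measurableType d)
    (P : probability T R) d' (S : measurableType d') k (Y : 'I_k -> T -> S) :
    Prop :=
  forall A : 'I_k -> set S, (forall i, measurable (A i)) ->
    P (\bigcap_i (Y i @^-1` A i)) = (\prod_(i < k) P (Y i @^-1` A i))%E.

Definition independent_pair (R : realType) d (T : measurableType d)
    (P : probability T R) d1 (S1 : measurableType d1) d2 (S2 : measurableType d2)
    (Y1 : T -> S1) (Y2 : T -> S2) : Prop :=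
  forall A1 A2, measurable A1 -> measurable A2 ->
    P (Y1 @^-1` A1 `&` Y2 @^-1` A2) = (P (Y1 @^-1` A1) * P (Y2 @^-1` A2))%E.

(* The variables Y_l may live on different probability spaces. *)
Definition cvg_in_distribution (R : realType)
    (d : nat -> measure_display) (T : forall l, measurableType (d l))
    (P : forall l, probability (T l) R)
    d' (T' : measurableType d') (P' : probability T' R)
    (V : topologicalType) (Y : forall l, T l -> V) (Y' : T' -> V) : Prop :=
  forall f : V -> R, continuous f -> (exists M, forall v, `|f v| <= M) ->
    ('E_(P l)[fun w => f (Y l w)])%E @[l --> \oo]
      --> ('E_P'[fun w => f (Y' w)])%E.

Definition cvg_in_probability (R : realType)
    (d : nat -> measure_display) (T : forall m, measurableType (d m))
    (P : forall m, probability (T m) R)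
    (S : Type) (dist : S -> S -> R) (Y : forall m, T m -> S) (y : S) : Prop :=
  forall e : R, 0 < e ->
    P m [set w | e < dist (Y m w) y] @[m --> \oo] --> 0%E.

Definition enlargement (R : realType) (S : Type) (dist : S -> S -> R)
    (A : set S) (e : R) : set S :=
  [set x | exists2 a, A a & dist a x < e].

(* The Levy-Prokhorov metric associated with the metric dist on S. *)
Definition levy_prokhorov (R : realType) d (S : measurableType d)
    (dist : S -> S -> R) (mu nu : set S -> \bar R) : R :=
  inf [set e : R | 0 < e /\ forall A, measurable A ->
         (mu A <= nu (enlargement dist A e) + e%:E)%E /\
         (nu A <= mu (enlargement dist A e) + e%:E)%E].

Definition euclidean_dist (R : realType) n (x y : 'rV[R]_n) : R :=
  pnorm 2%:E (x - y).

Definition empirical_measure (R : realType) d (S : measurableType d) m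
    (x : 'I_m -> S) (A : set S) : \bar R :=
  ((m%:R^-1)%:E * \sum_(i < m) \d_(x i) A)%E.

Arguments empirical_measure {R d S m} x A.

(* Main.v *)
(* The law of the first k blocks of m^(1/p) X has density proportional to
   (1 - sum_i |y_i|_q^p / m)_+ ^ ((m - k) n / p), because the section of the ball
   at y is a dilation of a ball in the remaining blocks; for p = oo it is uniform
   on a product of q-balls. After normalization these densities converge, by
   dominated convergence, to a product of densities proportional to
   exp (- n |y|_q^p / p), and polar coordinates for the cone measure identify
   this product with the law of the (|xi_i|^(1/n) Theta_i)_i. The convergence
   holds on every measurable set, not only in distribution. No volume or Gamma
   value is computed: all constants are determined by total mass 1.

   For (b), the marginals with k = 2 and the exchangeability of the blocks give
   E (mu_m A - mu A)^2 -> 0 for the empirical measure mu_m and every measurable A.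
   A partition of the space into finitely many small cells and one set of small
   mass turns this into convergence for the Levy-Prokhorov metric. The event
   {e < distance} is measurable because the distance to mu is a Lipschitz
   function of the sample points. *)

Require Import Defs.
From HB Require Import structures.
From mathcomp Require Import all_boot all_order all_algebra all_fingroup.
From mathcomp Require Import all_classical all_reals all_analysis.
From mathcomp Require Import measurable_realfun.
From mathcomp Require Import ring lra.
Import Order.TTheory GRing.Theory Num.Theory.
Import numFieldNormedType.Exports.
Local Open Scope classical_set_scope.
Local Open Scope ring_scope.

Set Implicit Arguments.
Unset Strict Implicit.
Unset Printing Implicit Defensive.

(** * Borel sets of matrices *)

Section borel_matrix.
Context {R : realType}.

(** The given laws having total mass 1 is the source of all finiteness. With the conventions for
    division in the extended reals, a quotient whose denominator is zero or infinite cannot equal 1,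
    so [X_law] and [Theta_law] force the balls to have positive finite volume. In the same way, the
    law of |xi|^(1/n) Theta having mass 1 gives the integrability of exp (- n |y|_q^p / p), which
    dominated convergence requires. Polar coordinates are taken with the n-th power of the radius:
    |xi| then corresponds to |x|_q^n, and the exponent p/n of the Gaussian turns back into p.
    Transformation rules for the volume come from comparing measures on boxes. Since the marginals
    converge on every measurable set, expectations of bounded functions follow by integrating tail
    probabilities, and the weak law asks only for the probabilities of one and of two blocks. The
    radii in (b) are handled as images of the blocks under the q-norm: the cone measure is carried
    by the sphere, so |xi|^(1/n) is almost surely the norm of |xi|^(1/n) Theta. *)

Definition box m n (A : 'I_m -> 'I_n -> set R) : set 'M[R]_(m, n) :=
  [set x | forall i j, A i j (x i j)].

Lemma open_measurable_mx m n (U : set 'M[R]_(m, n)) : open U -> measurable U.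
Proof. by move=> oU; exact: sub_sigma_algebra. Qed.

Lemma measurable_entry m n (i : 'I_m) (j : 'I_n) :
  measurable_fun setT (fun x : 'M[R]_(m, n) => x i j).
Proof.
apply: (measurability _ (RGenOpens.measurableE R)).
move=> _ [_ [a [b ->] <-]]; rewrite setTI; apply: open_measurable_mx.
apply: open_comp; last exact: interval_open.
by move=> x _; exact: coord_continuous.
Qed.

Lemma preimage_boxE T m n (f : T -> 'M[R]_(m, n)) (A : 'I_m -> 'I_n -> set R) :
  f @^-1` box A = \bigcap_(i in [set: 'I_m]) \bigcap_(j in [set: 'I_n])
    ((fun x => f x i j) @^-1` A i j).
Proof. by apply/seteqP; split=> x /= xA => [i _ j _|i j]; exact: xA. Qed.

Lemma measurable_preimage_box d (T : measurableType d) m n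
    (f : T -> 'M[R]_(m, n)) (A : 'I_m -> 'I_n -> set R) :
  (forall i j, measurable_fun setT (fun x => f x i j)) ->
  (forall i j, measurable (A i j)) -> measurable (f @^-1` box A).
Proof.
move=> mf mA; rewrite preimage_boxE.
apply: fin_bigcap_measurable => [|i _]; first exact: finite_finset.
apply: fin_bigcap_measurable => [|j _]; first exact: finite_finset.
by rewrite -[X in measurable X]setTI; exact: mf.
Qed.

Lemma measurable_box m n (A : 'I_m -> 'I_n -> set R) :
  (forall i j, measurable (A i j)) -> measurable (box A).
Proof.
by move=> mA; exact: (measurable_preimage_box (f := id) (@measurable_entry m n)).
Qed.

(** The index type is countable. These boxes serve twice: as a countable base of the topology, and,
    for a fixed second component, as a countable cover by small sets. *)
Definition rat_box m n (c : 'M[rat]_(m, n) * nat) : set 'M[R]_(m, n) :=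
  box (fun i j => ball (ratr (c.1 i j) : R) c.2.+1%:R^-1).

Lemma measurable_rat_box m n c : measurable (@rat_box m n c).
Proof. by apply: measurable_box => i j; exact: measurable_ball. Qed.

Lemma rat_box_cover m n (x : 'M[R]_(m, n)) k : exists c, rat_box (c, k) x.
Proof.
have k0 : 0 < k.+1%:R^-1 :> R by rewrite invr_gt0.
suff /choice[c cP] : forall ij, exists q : rat,
    ball (ratr q : R) k.+1%:R^-1 (x ij.1 ij.2).
  by exists (\matrix_(i, j) c (i, j)) => i j /=; rewrite mxE; exact: (cP (i, j)).
move=> [i j] /=.
have [q] := @rat_in_itvoo R _ _ (ltr_pwDr k0 (lexx (x i j))).
rewrite in_itv/= => /andP[q1 q2].
by exists q; rewrite /ball/= gtr0_norm ?subr_gt0// ltrBlDr addrC.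
Qed.

(** A rational box of radius below e / 2 that contains x lies in the ball of radius e around x,
    because balls of matrices are taken entrywise. *)
Lemma open_rat_boxE m n (U : set 'M[R]_(m, n)) : open U ->
  U = \bigcup_(c in [set c | rat_box c `<=` U]) rat_box c.
Proof.
move=> oU; apply/seteqP; split=> [x Ux|x [c /= + xc]]; last exact.
have /nbhs_ballP[e /= e0 eU] : nbhs x U by exact: open_nbhs_nbhs.
have [k ke] : exists k, k.+1%:R^-1 < e / 2.
  have e20 : 0 < e / 2 by rewrite divr_gt0.
  by have [k _ /(_ k (leqnn k))] := near_infty_natSinv_lt (PosNum e20); exists k.
have [c xc] := rat_box_cover x k.
exists (c, k) => //= y yc; apply: eU; split=> // i j.
rewrite (splitr e); apply: (@ball_triangle _ _ (ratr (c i j) : R)).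
  by apply: ball_sym; exact: le_ball (ltW ke) _ (xc i j).
exact: le_ball (ltW ke) _ (yc i j).
Qed.

Lemma measurable_mxP d (T : measurableType d) m n (f : T -> 'M[R]_(m, n)) :
  (forall i j, measurable_fun setT (fun x => f x i j)) -> measurable_fun setT f.
Proof.
move=> mf; apply: (measurability _ (erefl : @measurable _ 'M[R]_(m, n) = _)).
move=> _ [U oU <-]; rewrite setTI (open_rat_boxE oU) preimage_bigcup.
(* Boxes not contained in [U] are replaced by the empty set, so that the union runs over the whole
   countable index type. *)
rewrite bigcup_mkcond; apply: countable_bigcupT_measurable => // c.
case: ifP => // _; apply: measurable_preimage_box => // i j.
exact: measurable_ball.
Qed.

Lemma measurable_fun_entry d (T : measurableType d) m n
    (f : T -> 'M[R]_(m, n)) i j :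
  measurable_fun setT f -> measurable_fun setT (fun x => f x i j).
Proof. by move=> mf; exact: (measurableT_comp (measurable_entry i j) mf). Qed.

(** For the hard inclusion, the identity is read as a map out of the space carrying the
    sigma-algebra generated by boxes. Its entries are measurable there, so [measurable_mxP] makes
    every Borel set belong to that sigma-algebra. *)
Lemma measurable_mx_boxE m n :
  @measurable _ 'M[R]_(m, n) =
  <<s [set B | exists2 A, (forall i j, measurable (A i j)) & B = box A] >>.
Proof.
apply/seteqP; split=> [|]; last first.
  apply: smallest_sub; first exact: sigma_algebra_measurable.
  by move=> _ [A mA ->]; exact: measurable_box.
set G := [set _ | _].
pose T := g_sigma_algebraType G.
have : measurable_fun [set: T] (id : T -> 'M[R]_(m, n)).
  apply: measurable_mxP => i j _ A mA; rewrite setTI.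
  apply: sub_sigma_algebra; exists (fun i' j' => if (i' == i) && (j' == j) then A else setT).
    by move=> i' j'; case: ifP.
  apply/seteqP; split=> [x /= Ax i' j'|x /= /(_ i j)]; last by rewrite !eqxx.
  by case: ifP => // /andP[/eqP -> /eqP ->].
by move=> mid B mB; have := mid measurableT B mB; rewrite setTI.
Qed.

Lemma setI_closed_box m n : setI_closed
  [set B | exists2 A : 'I_m -> 'I_n -> set R,
    (forall i j, measurable (A i j)) & B = box A].
Proof.
move=> _ _ [A mA ->] [B mB ->]; exists (fun i j => A i j `&` B i j).
  by move=> i j; exact: measurableI.
apply/seteqP; split=> [x [xA xB] i j|x xAB]; first by split; [exact: xA|exact: xB].
by split=> i j; have [] := xAB i j.
Qed.

Definition cube m n k : set 'M[R]_(m, n) := box (fun _ _ => `[- k%:R, k%:R]%classic).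
Arguments cube : clear implicits.

Lemma bigcup_cube m n : \bigcup_k cube m n k = setT.
Proof.
apply/seteqP; split=> // x _.
have [k kx] : exists k : nat, forall i j, `|x i j| <= k%:R.
  pose M := \sum_i \sum_j `|x i j|.
  exists (Num.bound M) => i j; apply: (@le_trans _ _ M); last first.
    by apply/ltW/archi_boundP; apply: sumr_ge0 => ? _; apply: sumr_ge0.
  rewrite /M (bigD1 i)//= (bigD1 j)//= -addrA lerDl addr_ge0 ?sumr_ge0// => ? _.
  by rewrite sumr_ge0.
by exists k => // i j /=; rewrite in_itv/= -ler_norml.
Qed.

(** The pi-lambda theorem: boxes are stable under intersection and generate, and the cubes are boxes
    that exhaust the space. *)
Lemma mx_measure_unique m n (m1 m2 : {measure set 'M[R]_(m, n) -> \bar R}) :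
  (forall A, (forall i j, measurable (A i j)) -> m1 (box A) = m2 (box A)) ->
  (forall k, (m1 (cube m n k) < +oo)%E) ->
  forall A, measurable A -> m1 A = m2 A.
Proof.
move=> m12 m1oo; apply: (measure_unique _ (cube m n) (measurable_mx_boxE m n)) => //.
- exact: setI_closed_box.
- by move=> k; exists (fun _ _ => `[- k%:R, k%:R]%classic).
Arguments cube : clear implicits.
- exact: bigcup_cube.
- by move=> _ [A mA ->]; exact: m12.
Qed.

End borel_matrix.
Arguments cube {R} m n k.

(** * Volume on matrices *)

Section pushforward_along_measurable.
Context d1 d2 (T1 : measurableType d1) (T2 : measurableType d2) (R : realType).

(** The measure structure of a pushforward depends on a proof of measurability; naming the instance
    lets this proof be passed explicitly. *)
Definition image_measure (mu : {measure set T1 -> \bar R}) (f : T1 -> T2)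
    (mf : measurable_fun setT f) : {measure set T2 -> \bar R} :=
  measure_function_pushforward__canonical__measure_function_Measure mu mf.

Lemma image_measureE mu f (mf : measurable_fun setT f) A :
  image_measure mu mf A = mu (f @^-1` A).
Proof. by []. Qed.

End pushforward_along_measurable.

Section to_sigma_finite.
Context d (T : measurableType d) (R : realType).
Variables (mu : {measure set T -> \bar R}) (h : sigma_finite setT mu).

Let nu : set T -> \bar R := mu.

HB.instance Definition _ := Measure.on nu.
HB.instance Definition _ := Measure_isSigmaFinite.Build d T R nu h.

Definition to_sigma_finite : {sigma_finite_measure set T -> \bar R} := nu.

End to_sigma_finite.

Section volume.
Context {R : realType}.
Notation leb := (@lebesgue_measure R).

Lemma mx_sigma_finite m n (mu : {measure set 'M[R]_(m, n) -> \bar R}) :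
  (forall k, (mu (cube m n k) < +oo)%E) -> sigma_finite setT mu.
Proof.
move=> muoo; exists (cube m n); first by rewrite bigcup_cube.
by move=> k; split=> //; apply: measurable_box => i j; exact: measurable_itv.
Qed.

Lemma box_row_mx n (A : 'I_1 -> 'I_(1 + n) -> set R) :
  [set z : R * 'rV[R]_n | box A (row_mx z.1%:M z.2)] =
  A ord0 (lshift n ord0) `*` box (fun i j => A i (rshift 1 j)).
Proof.
apply/seteqP; split=> -[t v] /=; rewrite /box/=.
  move=> tvA; split=> [|i j].
    by have := tvA ord0 (lshift n ord0); rewrite row_mxEl mxE eqxx mulr1n.
  by have := tvA i (rshift 1 j); rewrite row_mxEr.
move=> [At Av] i j; rewrite (ord1 i).
case: (split_ordP j) => k ->; last by rewrite row_mxEr.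
by rewrite row_mxEl (ord1 k) mxE eqxx mulr1n.
Qed.

Lemma measurable_row_mx m n1 n2 d (T : measurableType d)
    (f : T -> 'M[R]_(m, n1)) (g : T -> 'M[R]_(m, n2)) :
  measurable_fun setT f -> measurable_fun setT g ->
  measurable_fun setT (fun x => row_mx (f x) (g x)).
Proof.
move=> mf mg; apply: measurable_mxP => i j.
case: (split_ordP j) => k ->.
  by under eq_fun do rewrite row_mxEl; exact: measurable_fun_entry.
by under eq_fun do rewrite row_mxEr; exact: measurable_fun_entry.
Qed.

Lemma measurable_scalar_mx d (T : measurableType d) (f : T -> R) :
  measurable_fun setT f -> measurable_fun setT (fun x => (f x)%:M : 'M[R]_1).
Proof.
move=> mf; apply: measurable_mxP => i j.
by rewrite (ord1 i) (ord1 j); under eq_fun do rewrite mxE eqxx mulr1n.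
Qed.

Lemma lebesgue_cube_ltoo k : (leb `[(- k%:R)%R, k%:R%R]%classic < +oo)%E.
Proof. by rewrite lebesgue_measure_itv/=; case: ifP => _ //; rewrite -EFinD ltry. Qed.

Lemma prode_ltoo I (s : seq I) (f : I -> \bar R) :
  (forall i, (0 <= f i < +oo)%E) -> (\prod_(i <- s) f i < +oo)%E.
Proof.
move=> foo; elim: s => [|i s IH]; first by rewrite big_nil ltry.
have /andP[f0 fi] := foo i.
rewrite big_cons lte_mul_pinfty// ge0_fin_numE//.
Qed.

(** [vol_row] is a bare set function. The induction carries the measure structure together with the
    value on boxes, since that value makes the cubes finite and hence the previous volume
    sigma-finite, as the product requires. *)
Lemma vol_row_measure n : exists mu : {measure set 'rV[R]_n -> \bar R},
  @vol_row R n = mu /\ forall A : 'I_1 -> 'I_n -> set R,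
    (forall i j, measurable (A i j)) ->
    mu (box A) = (\prod_(j < n) leb (A ord0 j))%E.
Proof.
elim: n => [|n [mu [muE mubox]]].
  exists (@dirac _ _ (0 : 'rV[R]_0) R); split=> // A mA.
  by rewrite big_ord0/= diracE mem_set// => i [].
have muoo k : (mu (cube 1 n k) < +oo)%E.
  rewrite mubox => [|i j]; last exact: measurable_itv.
  by apply: prode_ltoo => j; rewrite measure_ge0 lebesgue_cube_ltoo.
pose mu' := to_sigma_finite (mx_sigma_finite muoo).
pose phi (z : R * 'rV[R]_n) : 'rV[R]_(1 + n) := row_mx z.1%:M z.2.
have mphi : measurable_fun setT phi.
  by apply: measurable_row_mx => //; exact: measurable_scalar_mx.
exists (image_measure (leb \x mu')%E mphi); split=> [|A mA].
  by apply/funext => B; rewrite /= muE.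
rewrite image_measureE (box_row_mx A : phi @^-1` _ = _).
rewrite [LHS]product_measure1E; [|exact: mA|by apply: measurable_box => i j; exact: mA].
rewrite [X in (_ * X)%E]mubox; last by move=> i j; exact: mA.
rewrite big_ord_recl; congr (leb _ * _)%E; first by congr (A _ _); exact: val_inj.
by apply: eq_bigr => j _; congr (leb (A _ _)); exact: val_inj.
Qed.

Lemma measurable_vec_mx m n : measurable_fun setT (@vec_mx R m n).
Proof.
apply: measurable_mxP => i j.
by under eq_fun do rewrite mxE; exact: measurable_entry.
Qed.

Lemma vol_mx_measure m n : exists mu : {measure set 'M[R]_(m, n) -> \bar R},
  @vol_mx R m n = mu /\ forall A : 'I_m -> 'I_n -> set R,
    (forall i j, measurable (A i j)) ->
    mu (box A) = (\prod_(i < m) \prod_(j < n) leb (A i j))%E.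
Proof.
have [mu [muE mubox]] := vol_row_measure (m * n).
exists (image_measure mu (@measurable_vec_mx m n)); split=> [|A mA].
  by apply/funext => B; rewrite /vol_mx muE.
rewrite image_measureE.
(* The inverse of [mxvec_index]: from a position in the flattened row to its pair of indices. *)
pose f (ij : 'I_(m * n)) : 'I_m * 'I_n :=
  enum_val (cast_ord (esym (mxvec_cast m n)) ij).
have fK i j : f (mxvec_index i j) = (i, j).
  by rewrite /f /mxvec_index cast_ordK enum_rankK.
have -> : vec_mx @^-1` box A = box (fun _ ij => A (f ij).1 (f ij).2).
  apply/seteqP; split=> x /= xA.
    by move=> i ij; rewrite (ord1 i); case: (mxvec_indexP ij) => a b;
      rewrite fK/=; have := xA a b; rewrite mxE.
  by move=> a b; rewrite mxE; have := xA ord0 (mxvec_index a b); rewrite fK.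
rewrite mubox; last by move=> _ ij; exact: mA.
rewrite pair_big/= (reindex _ (curry_mxvec_bij m n)).
by apply: eq_bigr => -[i j] _; rewrite /= fK.
Qed.

Lemma mx_cube_ltoo m n (mu : {measure set 'M[R]_(m, n) -> \bar R}) :
  (forall A : 'I_m -> 'I_n -> set R, (forall i j, measurable (A i j)) ->
    mu (box A) = (\prod_(i < m) \prod_(j < n) leb (A i j))%E) ->
  forall k, (mu (cube m n k) < +oo)%E.
Proof.
move=> mubox k; rewrite mubox => [|i j]; last exact: measurable_itv.
apply: prode_ltoo => i; rewrite prode_ge0//=.
by apply: prode_ltoo => j; rewrite measure_ge0 lebesgue_cube_ltoo.
Qed.

(** A sigma type instead of an existential, so that [Vol] can be projected out as a structured
    measure. *)
Lemma vol_mx_sigma_finite_measure m n :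
  {mu : {sigma_finite_measure set 'M[R]_(m, n) -> \bar R} |
   @vol_mx R m n = mu /\ forall A : 'I_m -> 'I_n -> set R,
    (forall i j, measurable (A i j)) ->
    mu (box A) = (\prod_(i < m) \prod_(j < n) leb (A i j))%E}.
Proof.
apply: cid; have [mu [muE mubox]] := vol_mx_measure m n.
by exists (to_sigma_finite (mx_sigma_finite (mx_cube_ltoo mubox))).
Qed.

Definition Vol m n : {sigma_finite_measure set 'M[R]_(m, n) -> \bar R} :=
  sval (vol_mx_sigma_finite_measure m n).

Lemma vol_mxE m n : @vol_mx R m n = Vol m n.
Proof. exact: (svalP (vol_mx_sigma_finite_measure m n)).1. Qed.

Lemma Vol_box m n (A : 'I_m -> 'I_n -> set R) :
  (forall i j, measurable (A i j)) ->
  Vol m n (box A) = (\prod_(i < m) \prod_(j < n) leb (A i j))%E.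
Proof. exact: (svalP (vol_mx_sigma_finite_measure m n)).2. Qed.

(** The tool for the transformation rules below (stacking, row permutation, dilation): an image of
    the volume is identified by its values on boxes. *)
Lemma Vol_unique m n (mu : {measure set 'M[R]_(m, n) -> \bar R}) :
  (forall A : 'I_m -> 'I_n -> set R, (forall i j, measurable (A i j)) ->
    mu (box A) = (\prod_(i < m) \prod_(j < n) leb (A i j))%E) ->
  forall A, measurable A -> mu A = Vol m n A.
Proof.
move=> mubox; apply: mx_measure_unique => [A mA|]; last exact: mx_cube_ltoo.
by rewrite mubox// Vol_box.
Qed.

Lemma vol_rowE n A : measurable A -> @vol_row R n A = Vol 1 n A.
Proof.
have [mu [-> mubox]] := vol_row_measure n.
apply: Vol_unique => B mB; rewrite mubox//.
by rewrite big_ord1.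
Qed.

Lemma measurable_col_mx k l n :
  measurable_fun setT
    (fun z : 'M[R]_(k, n) * 'M[R]_(l, n) => col_mx z.1 z.2).
Proof.
apply: measurable_mxP => i j; case: (split_ordP i) => a ->.
  by under eq_fun do rewrite col_mxEu; apply: measurable_fun_entry.
by under eq_fun do rewrite col_mxEd; apply: measurable_fun_entry.
Qed.

Lemma Vol_col_mx k l n (A : set 'M[R]_(k + l, n)) : measurable A ->
  Vol (k + l) n A =
  (Vol k n \x Vol l n)%E [set z | A (col_mx z.1 z.2)].
Proof.
move=> mA.
have := @Vol_unique _ _ (image_measure (Vol k n \x Vol l n)%E
  (@measurable_col_mx k l n)).
move=> <- // B mB; rewrite image_measureE.
have -> : (fun z : 'M[R]_(k, n) * 'M[R]_(l, n) => col_mx z.1 z.2) @^-1` box B =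
   box (fun i j => B (lshift l i) j) `*` box (fun i j => B (rshift k i) j).
  apply/seteqP; split=> -[x y] /=.
    move=> xyB; split=> i j.
      by have := xyB (lshift l i) j; rewrite col_mxEu.
    by have := xyB (rshift k i) j; rewrite col_mxEd.
  move=> [xB yB] i j; case: (split_ordP i) => a ->.
    by rewrite col_mxEu; exact: xB.
  by rewrite col_mxEd; exact: yB.
rewrite [LHS]product_measure1E; [|by apply: measurable_box..].
by rewrite big_split_ord/=; congr (_ * _)%E; rewrite -Vol_box.
Qed.

Lemma Vol_row_perm m n (s : 'S_m) (A : set 'M[R]_(m, n)) : measurable A ->
  Vol m n (row_perm s @^-1` A) = Vol m n A.
Proof.
move=> mA.
have ms : measurable_fun setT (@row_perm R m n s).
  by apply: measurable_mxP => i j; under eq_fun do rewrite mxE; exact: measurable_entry.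
apply: (Vol_unique (mu := image_measure (Vol m n) ms)) => // B mB.
rewrite image_measureE (_ : _ @^-1` _ = box (fun i j => B ((s^-1)%g i) j)).
  rewrite Vol_box// (reindex_inj (@perm_inj _ s))/=.
  by under eq_bigr do rewrite permK.
apply/seteqP; split=> x /= xB i j.
  by have := xB ((s^-1)%g i) j; rewrite mxE permKV.
by rewrite mxE; have := xB (s i) j; rewrite permK.
Qed.

(** The image of the Lebesgue measure under multiplication by s, multiplied by s, gives half-open
    intervals their length. *)
Lemma lebesgue_scale (s : R) (A : set R) : (0 < s)%R -> measurable A ->
  leb ((fun x => s * x) @^-1` A) = ((s^-1)%:E * leb A)%E.
Proof.
move=> s0 mA.
have ms : measurable_fun setT
  (fun x : measurableTypeR R => s * x : measurableTypeR R).
  exact: measurable_funM.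
have s0' := ltW s0.
pose mu : {measure set _ -> \bar R} := mscale (NngNum s0') (image_measure leb ms).
have muE B : mu B = (s%:E * leb ((fun x => (s * x)%R) @^-1` B))%E by [].
have -> : leb A = mu A.
  apply: (@lebesgue_measure_unique R mu) => // _ [[a b] _ <-].
  rewrite muE (_ : _ @^-1` _ = `]s^-1 * a, s^-1 * b]%classic); last first.
    by apply/seteqP; split=> x /=; rewrite !in_itv/= ltr_pdivrMl// ler_pdivlMl.
  rewrite !lebesgue_measure_itv/= !lte_fin ltr_pM2l ?invr_gt0//.
  case: ifP => _; last by rewrite mule0.
  by rewrite -!EFinB -EFinM -mulrBr mulVKf// gt_eqF.
by rewrite muE muleA -EFinM mulVf ?mul1e// gt_eqF.
Qed.

Lemma measurable_scale_mx m n (s : R) :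
  measurable_fun setT (fun x : 'M[R]_(m, n) => s *: x).
Proof.
apply: measurable_mxP => i j; under eq_fun do rewrite mxE.
by apply: measurable_funM => //; exact: measurable_entry.
Qed.

Lemma Vol_scale m n (s : R) (A : set 'M[R]_(m, n)) : 0 < s -> measurable A ->
  Vol m n ((fun x => s *: x) @^-1` A) = ((s^-1 ^+ (m * n))%:E * Vol m n A)%E.
Proof.
move=> s0 mA.
have s0' : 0 <= s ^+ (m * n) by rewrite exprn_ge0 ?ltW.
pose mu : {measure set _ -> \bar R} :=
  mscale (NngNum s0') (image_measure (Vol m n) (@measurable_scale_mx m n s)).
have muE B : mu B =
  ((s ^+ (m * n))%:E * Vol m n ((fun x => (s *: x)%R) @^-1` B))%E by [].
have <- : mu A = Vol m n A.
  apply: Vol_unique => // B mB; rewrite muE.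
  rewrite (_ : _ @^-1` _ = box (fun i j => (fun x => s * x) @^-1` B i j)).
    rewrite Vol_box; last first.
      by move=> i j; rewrite -[X in measurable X]setTI; exact: measurable_funM.
    transitivity ((s ^+ (m * n))%:E *
        \prod_(i < m) ((s^-1 ^+ n)%:E * \prod_(j < n) leb (B i j)))%E.
      congr (_ * _)%E; apply: eq_bigr => i _.
      under eq_bigr do rewrite lebesgue_scale//.
      rewrite big_split/=; congr (_ * _)%E.
      by rewrite prodEFin prodr_const card_ord.
    rewrite big_split/= prodEFin prodr_const card_ord muleA -EFinM.
    by rewrite -exprM mulnC -exprMn mulfV ?gt_eqF// expr1n mul1e.
  by apply/seteqP; split=> x /= xB i j; have := xB i j; rewrite mxE.
rewrite muE muleA -EFinM -exprMn mulVf ?gt_eqF//.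
by rewrite expr1n mul1e.
Qed.

End volume.

(** * Mixed norms, their balls and sublevel sets *)

Section block_norms.
Context {R : realType}.
Implicit Types (p q : \bar R).

Lemma pnorm_ge0 p n (x : 'rV[R]_n) : 0 <= pnorm p x.
Proof.
case: p => [r| |] /=; first exact: powR_ge0.
- by elim/big_ind : _ => // a b a0 b0; rewrite le_max a0.
- by elim/big_ind : _ => // a b a0 b0; rewrite le_max a0.
Qed.

Lemma measurable_bigmax d (T : measurableType d) I (s : seq I) (f : I -> T -> R) :
  (forall i, measurable_fun setT (f i)) ->
  measurable_fun setT (fun x => \big[Num.max/0]_(i <- s) f i x).
Proof.
move=> mf; elim: s => [|i s IH].
  by under eq_fun do rewrite big_nil; exact: measurable_cst.
by under eq_fun do rewrite big_cons; exact: measurable_maxr.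
Qed.

Lemma measurable_pnorm p n : measurable_fun setT (@pnorm R p n).
Proof.
have mnorm (i : 'I_n) : measurable_fun setT (fun x : 'rV[R]_n => `|x 0 i|).
  by apply: measurableT_comp => //; exact: measurable_entry.
case: p => [r| |] /=; [|exact: measurable_bigmax..].
apply: (measurableT_comp (measurable_powR r^-1)).
by apply: measurable_sum => i; exact: (measurableT_comp (measurable_powR r)).
Qed.

Lemma pnormZ p n (s : R) (x : 'rV[R]_n) : (0 < p)%E -> 0 <= s ->
  pnorm p (s *: x) = s * pnorm p x.
Proof.
have maxZ : 0 <= s -> \big[Num.max/0]_(i < n) `|(s *: x) 0 i| =
    s * \big[Num.max/0]_(i < n) `|x 0 i|.
  move=> s0; rewrite (big_morph ( *%R s) (fun a b => maxr_pMr a b s0) (mulr0 s)).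
  by apply: eq_bigr => i _; rewrite mxE normrM ger0_norm.
case: p => [r| |] //=.
rewrite lte_fin => r0 s0.
under eq_bigr do rewrite mxE normrM (ger0_norm s0) powRM//.
rewrite -mulr_sumr powRM ?powR_ge0 ?sumr_ge0//.
by rewrite -powRrM mulfV ?gt_eqF// powRr1.
Qed.

(** The r-th power of the mixed norm for finite p = r. Unlike the norm it is additive over stacked
    blocks, which makes the sections of the ball sublevel sets again. *)
Definition bsum q (r : R) m n (y : 'M[R]_(m, n)) : R :=
  \sum_(i < m) pnorm q (row i y) `^ r.

Lemma bsum_ge0 q r m n (y : 'M[R]_(m, n)) : 0 <= bsum q r y.
Proof. by apply: sumr_ge0 => i _; exact: powR_ge0. Qed.

Lemma measurable_row m n (i : 'I_m) : measurable_fun setT (@row R m n i).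
Proof.
by apply: measurable_mxP => a j; under eq_fun do rewrite mxE; exact: measurable_entry.
Qed.

Lemma measurable_pnorm_row q m n (i : 'I_m) :
  measurable_fun setT (fun y : 'M[R]_(m, n) => pnorm q (row i y)).
Proof.
apply: (@measurableT_comp _ _ _ _ _ _ (@pnorm R q n)); first exact: measurable_pnorm.
exact: measurable_row.
Qed.

Lemma measurable_bsum q r m n : measurable_fun setT (@bsum q r m n).
Proof.
apply: measurable_sum => i.
exact: (measurableT_comp (measurable_powR r) (measurable_pnorm_row q i)).
Qed.

Lemma rowZ m n (i : 'I_m) (s : R) (y : 'M[R]_(m, n)) :
  row i (s *: y) = s *: row i y.
Proof. by apply/rowP => j; rewrite !mxE. Qed.

Lemma bsumZ q r m n (s : R) (y : 'M[R]_(m, n)) : (0 < q)%E -> 0 <= s ->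
  bsum q r (s *: y) = s `^ r * bsum q r y.
Proof.
move=> q0 s0; rewrite /bsum mulr_sumr; apply: eq_bigr => i _.
by rewrite rowZ pnormZ// powRM// pnorm_ge0.
Qed.

Lemma bsum_col_mx q r k l n (y : 'M[R]_(k, n)) (z : 'M[R]_(l, n)) :
  bsum q r (col_mx y z) = bsum q r y + bsum q r z.
Proof.
rewrite /bsum big_split_ord/=; congr (_ + _); apply: eq_bigr => i _.
  by rewrite rowKu.
by rewrite rowKd.
Qed.

Lemma one_powR (r : R) : 1 `^ r = 1.
Proof. by rewrite powR1. Qed.

Lemma pqball_finE (r : R) q m n : 0 < r ->
  pqball r%:E q m n = [set x | bsum q r x <= 1].
Proof.
move=> r0; apply/seteqP; rewrite /pqball /pqnorm; split=> x /=.
all: under eq_bigr do rewrite mxE ger0_norm ?pnorm_ge0//.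
all: rewrite -/(bsum q r x).
  move=> h; rewrite leNgt; apply/negP => h1; move: h; apply/negP.
  rewrite -ltNge -[X in X < _](one_powR r^-1) gt0_ltr_powR ?invr_gt0// nnegrE//.
  exact: bsum_ge0.
move=> h; rewrite -(one_powR r^-1).
by rewrite ge0_ler_powR ?invr_ge0 ?nnegrE ?bsum_ge0// ltW.
Qed.

Lemma pqball_infE q m n :
  pqball +oo%E q m n = [set x : 'M[R]_(m, n) | forall i, pnorm q (row i x) <= 1].
Proof.
apply/seteqP; rewrite /pqball /pqnorm/=; split=> x /=.
  move=> h i; apply: le_trans h; rewrite (bigD1 i)//= le_max.
  by rewrite mxE ger0_norm ?lexx// pnorm_ge0.
move=> h; elim/big_ind : _ => // [a b a1 b1|i _]; first by rewrite ge_max a1.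
by rewrite mxE ger0_norm ?pnorm_ge0.
Qed.

Lemma measurable_sublevel d (T : measurableType d) (f : T -> R) (a : R) :
  measurable_fun setT f -> measurable [set x | f x <= a].
Proof.
move=> mf; rewrite (_ : mkset _ = f @^-1` `]-oo, a]%classic).
  by rewrite -[X in measurable X]setTI; apply: mf => //; exact: measurable_itv.
by apply/seteqP; split=> x /=; rewrite in_itv.
Qed.

Lemma measurable_pqball p q m n : (0 < p)%E -> measurable (@pqball R p q m n).
Proof.
case: p => [r| |]//; rewrite ?lte_fin => r0.
  by rewrite pqball_finE//; apply: measurable_sublevel; exact: measurable_bsum.
rewrite pqball_infE (_ : mkset _ = \bigcap_(i in [set: 'I_m])
    [set x : 'M[R]_(m, n) | pnorm q (row i x) <= 1]); last first.
  by apply/seteqP; split=> x /= h i; [move=> _; exact: h|exact: h i I].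
apply: fin_bigcap_measurable => [|i _]; first exact: finite_finset.
by apply: measurable_sublevel; exact: measurable_pnorm_row.
Qed.

Lemma row_row_perm m n (s : 'S_m) i (x : 'M[R]_(m, n)) :
  row i (row_perm s x) = row (s i) x.
Proof. by apply/rowP => j; rewrite !mxE. Qed.

Lemma pqball_row_perm p q m n (s : 'S_m) (x : 'M[R]_(m, n)) :
  pqball p q m n (row_perm s x) = pqball p q m n x.
Proof.
rewrite /pqball/= /pqnorm/=; congr (_ <= 1 : Prop).
case: p => [r| |]/=; under eq_bigr do rewrite mxE row_row_perm;
  rewrite [in RHS](reindex_inj (@perm_inj _ s))/=;
  by under [in RHS]eq_bigr do rewrite mxE.
Qed.

(* Scaling by 2 multiplies the volume by 2 ^ (m * n) but preserves D. *)
Lemma Vol_cone0 m n (D : set 'M[R]_(m, n)) : (0 < m * n)%N -> measurable D ->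
  (forall x, D (2 *: x) = D x) -> (Vol m n D < +oo)%E -> Vol m n D = 0%E.
Proof.
move=> mn0 mD D2 Doo.
have := Vol_scale (ltr0n R 2) mD.
rewrite (_ : _ @^-1` D = D); last by apply/funext => x; rewrite /preimage/= D2.
have : Vol m n D \is a fin_num by rewrite ge0_fin_numE.
move/fineK => <-; rewrite -EFinM => -[] /eqP.
rewrite -subr_eq0 -[X in X - _]mul1r -mulrBl mulf_eq0 => /orP[|/eqP -> //].
rewrite subr_eq0 => /eqP/esym/eqP; rewrite exprVn invr_eq1 => /eqP e1.
have : 1 < (2 : R) ^+ (m * n) by rewrite exprn_egt1// ?ltr1n// -lt0n.
by rewrite e1 ltxx.
Qed.

(** For 0 < s the set is the dilation by s^(1/r) of the set at level 1, and for s < 0 it is empty.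
    The level s = 0 is invariant under doubling, hence null by [Vol_cone0]; the right side vanishes
    there because the exponent is nonzero. *)
Lemma Vol_sublevel q (r : R) m n (s : R) : 0 < r -> (0 < q)%E ->
  (0 < m * n)%N -> (Vol m n [set z | (bsum q r z <= 1)%R] < +oo)%E ->
  Vol m n [set z | bsum q r z <= s] =
  ((Num.max 0 s `^ ((m * n)%:R / r))%:E *
    Vol m n [set z | (bsum q r z <= 1)%R])%E.
Proof.
move=> r0 q0 mn0 voo.
have mS a : measurable [set z : 'M[R]_(m, n) | bsum q r z <= a].
  by apply: measurable_sublevel; exact: measurable_bsum.
have e0 : (m * n)%:R / r != 0 by rewrite mulf_neq0 ?invr_eq0 ?gt_eqF// ltr0n.
have [s0|s0|s0] := ltgtP 0 s.
- have t0 : 0 < s `^ r^-1 by exact: powR_gt0.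
  have tr : (s `^ r^-1)^-1 `^ r = s^-1.
    by rewrite -powRN -powRrM mulNr mulVf ?gt_eqF// powR_inv1// ltW.
  transitivity (Vol m n ((fun x => (s `^ r^-1)^-1 *: x) @^-1`
      [set z | bsum q r z <= 1])).
    congr (Vol m n _); apply/seteqP; split=> z /=;
    by rewrite bsumZ ?invr_ge0 ?(ltW t0)// tr ler_pdivrMl// mulr1.
  rewrite Vol_scale ?invr_gt0// invrK -powR_mulrn ?ltW// -powRrM.
  by rewrite mulrC.
- rewrite powR0// mul0e (_ : mkset _ = set0) ?measure0//.
  apply/seteqP; split=> // z /=; apply/negP; rewrite -ltNge (lt_le_trans s0)//.
  exact: bsum_ge0.
- rewrite -s0 powR0// mul0e; apply: Vol_cone0 => //.
    move=> x /=; rewrite bsumZ//; congr (_ : Prop).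
    by rewrite pmulr_rle0// powR_gt0.
  apply: le_lt_trans voo; apply: le_measure; rewrite ?inE//.
  by move=> z /= /le_trans; apply.
Qed.

End block_norms.

(** * Densities, image measures and integrals against the volume *)

Section density.
Context d (T : measurableType d) (R : realType).
Variables (mu : {measure set T -> \bar R}) (f : T -> \bar R).
Hypothesis (mf : measurable_fun setT f) (f0 : forall x, (0 <= f x)%E).

Let nu (A : set T) := (\int[mu]_(x in A) f x)%E.

Let nu0 : nu set0 = 0%E. Proof. exact: integral_set0. Qed.

Let nu_ge0 A : (0 <= nu A)%E. Proof. exact: integral_ge0. Qed.

HB.instance Definition _ := isMeasure.Build _ _ _ nu nu0 nu_ge0
  (semi_sigma_additive_nng_induced mf f0).

Definition density_measure : {measure set T -> \bar R} := nu.

Lemma density_measureE A : density_measure A = (\int[mu]_(x in A) f x)%E.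
Proof. by []. Qed.

End density.

Section image_integral.
Context d1 d2 (T1 : measurableType d1) (T2 : measurableType d2) (R : realType).

Lemma integral_image (mu : {measure set T1 -> \bar R}) (phi : T1 -> T2)
    (mphi : measurable_fun setT phi) (f : T2 -> \bar R) :
  measurable_fun setT f -> (forall y, (0 <= f y)%E) ->
  (\int[image_measure mu mphi]_y f y = \int[mu]_x f (phi x))%E.
Proof.
move=> mf f0; by rewrite (@ge0_integral_pushforward _ _ _ _ _ _ mphi).
Qed.

End image_integral.

Section volume_integrals.
Context {R : realType}.

Lemma integral_col_mx k l n (F : 'M[R]_(k + l, n) -> \bar R) :
  measurable_fun setT F -> (forall x, (0 <= F x)%E) ->
  (\int[Vol (k + l) n]_x F x =
   \int[Vol k n]_y \int[Vol l n]_z F (col_mx y z))%E.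
Proof.
move=> mF F0.
rewrite -(fubini_tonelli1 (fun z => F (col_mx z.1 z.2)))//=; last first.
  exact: (measurableT_comp mF (@measurable_col_mx R k l n)).
rewrite -(integral_image _ (@measurable_col_mx R k l n))//.
by apply: eq_measure_integral => A mA _; exact: Vol_col_mx.
Qed.

Lemma row_col_mx0 k n (y : 'rV[R]_n) (z : 'M[R]_(k, n)) :
  @row R k.+1 n ord0 (col_mx y z) = y.
Proof.
rewrite (_ : ord0 = lshift k (ord0 : 'I_1)); last exact: val_inj.
by rewrite (rowKu ord0 y z); apply/rowP => j; rewrite mxE ord1.
Qed.

Lemma row_col_mxS k n (y : 'rV[R]_n) (z : 'M[R]_(k, n)) i :
  @row R k.+1 n (lift ord0 i) (col_mx y z) = row i z.
Proof.
rewrite (_ : lift ord0 i = rshift 1 i); last exact: val_inj.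
exact: (rowKd i y z).
Qed.

Lemma integral_prod_rows n k (f : 'I_k -> 'rV[R]_n -> R) :
  (forall i, measurable_fun setT (f i)) -> (forall i v, 0 <= f i v) ->
  (\int[Vol k n]_x (\prod_(i < k) f i (row i x))%:E =
   \prod_(i < k) \int[Vol 1 n]_v (f i v)%:E)%E.
Proof.
elim: k f => [|k IH] f mf f0.
  (* Without rows the matrix space is a single point, an empty box of volume 1. *)
  under eq_integral do rewrite big_ord0.
  rewrite integral_cst// mul1e big_ord0.
  rewrite (_ : setT = box (fun _ _ => setT)); last by apply/seteqP; split.
  by rewrite Vol_box// big_ord0.
have mrowf m i (g : 'rV[R]_n -> R) : measurable_fun setT g ->
    measurable_fun setT (fun x : 'M[R]_(m, n) => g (row i x)).
  by move=> mg; apply: (measurableT_comp mg); exact: measurable_row.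
rewrite (@integral_col_mx 1 k n); last 2 first.
- apply/measurable_EFinP; apply: (@measurable_prod _ _ R) => i _; exact: mrowf.
- by move=> x; rewrite lee_fin prodr_ge0.
under eq_integral => y _.
  under eq_integral => z _.
    rewrite big_ord_recl EFinM row_col_mx0.
    under eq_bigr => i _ do rewrite row_col_mxS.
    over.
  rewrite ge0_integralZl ?lee_fin//; last 2 first.
  - apply/measurable_EFinP; apply: (@measurable_prod _ _ R) => i _; exact: mrowf.
  - by move=> x _; rewrite lee_fin prodr_ge0.
  rewrite (IH (fun i => f (lift ord0 i)))//.
  over.
rewrite ge0_integralZr//; last 3 first.
- exact/measurable_EFinP.
- by move=> x _; rewrite lee_fin.
- by apply: prode_ge0 => i _; apply: integral_ge0 => x _; rewrite lee_fin.
by rewrite big_ord_recl.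
Qed.

Lemma integral_scale_mx m n (s : R) (F : 'M[R]_(m, n) -> \bar R) : 0 < s ->
  measurable_fun setT F -> (forall x, (0 <= F x)%E) ->
  (\int[Vol m n]_x F (s *: x)%R =
   (s^-1 ^+ (m * n))%:E * \int[Vol m n]_x F x)%E.
Proof.
move=> s0 mF F0.
rewrite -(integral_image _ (@measurable_scale_mx R m n s))//.
have s0' : 0 <= s^-1 ^+ (m * n) by rewrite exprn_ge0 ?invr_ge0 ?ltW.
rewrite -(ge0_integral_mscale _ measurableT (NngNum s0'))//.
by apply: eq_measure_integral => A mA _; exact: Vol_scale.
Qed.

(** At the constant [c0] the integral factors over the rows; a dilation by (c / c0)^(1/r) reaches
    any other constant. This allows a dominating function with half the constant of the limit. *)
Lemma integral_exp_bsum_ltoo q (r c0 c : R) n k :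
  0 < r -> (0 < q)%E -> 0 < c0 -> 0 < c ->
  (\int[Vol 1 n]_v (expR (- (c0 * pnorm q v `^ r)))%:E < +oo)%E ->
  (\int[Vol k n]_x (expR (- (c * bsum q r x)))%:E < +oo)%E.
Proof.
move=> r0 q0 c00 c_0 oo.
have mexp (c1 : R) m : measurable_fun setT
    (fun x : 'M[R]_(m, n) => (expR (- (c1 * bsum q r x)))%:E).
  apply/measurable_EFinP; apply: measurableT_comp => //.
  apply: measurableT_comp => //; apply: measurable_funM => //.
  exact: measurable_bsum.
have k0 : (\int[Vol k n]_x (expR (- (c0 * bsum q r x)))%:E < +oo)%E.
  under eq_integral do rewrite /bsum mulr_sumr -sumrN expR_sum.
  rewrite (integral_prod_rows (f := fun _ v => expR (- (c0 * pnorm q v `^ r)))).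
  - apply: prode_ltoo => i; rewrite oo andbT.
    by apply: integral_ge0 => x _; rewrite lee_fin expR_ge0.
  - move=> _; apply: measurableT_comp => //.
    apply: measurableT_comp => //; apply: measurable_funM => //.
    apply: (measurableT_comp (measurable_powR r)); exact: measurable_pnorm.
  - by move=> _ v; exact: expR_ge0.
pose s := (c / c0) `^ r^-1.
have s0 : 0 < s by rewrite powR_gt0 // divr_gt0.
have cE x : (expR (- (c * bsum q r x)))%:E =
    (expR (- (c0 * bsum q r (s *: x))))%:E :> \bar R.
  rewrite bsumZ ?ltW// /s -powRrM mulVf ?gt_eqF// powRr1 ?ltW ?divr_gt0//.
  by rewrite mulrA mulrCA mulfV ?gt_eqF// mulr1.
under eq_integral do rewrite cE.
rewrite (integral_scale_mx s0 (mexp c0 k)).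
  by rewrite lte_mul_pinfty// lee_fin exprn_ge0// invr_ge0 ltW.
by move=> x; rewrite lee_fin expR_ge0.
Qed.

End volume_integrals.

Lemma preimage_measurable d1 d2 (T1 : measurableType d1) (T2 : measurableType d2)
    (f : T1 -> T2) (A : set T2) :
  measurable_fun setT f -> measurable A -> measurable (f @^-1` A).
Proof. by move=> mf mA; rewrite -[X in measurable X]setTI; exact: mf. Qed.

(** Neither measure has to be a product. Finiteness of [m1] allows the whole space as a constant
    exhausting sequence. *)
Lemma rectangle_measure_unique d1 d2 (T1 : measurableType d1)
    (T2 : measurableType d2) (R : realType)
    (m1 m2 : {measure set (T1 * T2) -> \bar R}) :
  (m1 setT < +oo)%E ->
  (forall A B, measurable A -> measurable B -> m1 (A `*` B) = m2 (A `*` B)) ->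
  forall D, measurable D -> m1 D = m2 D.
Proof.
move=> m1oo m12 D mD.
pose G := [set A `*` B | A in @measurable _ T1 & B in @measurable _ T2].
apply: (measure_unique G (fun _ => setT)) => //.
- exact: measurable_prod_measurableType.
- move=> _ _ [A mA [B mB <-]] [A' mA' [B' mB' <-]].
  rewrite -setXI; exists (A `&` A'); first exact: measurableI.
  by exists (B `&` B') => //; exact: measurableI.
- by move=> _; rewrite -setXTT; exists setT => //; exists setT.
- by apply/seteqP; split=> // x _; exists 0%N.
- by move=> _ [A mA [B mB <-]]; exact: m12.
Qed.

(* Since 0^-1 = +oo and +oo^-1 = 0, a normalized measure mu A / mu B = 1 forces
   mu B to be positive and finite. *)
Lemma ediv_eq1 (R : realType) (a b : \bar R) : (0 <= a)%E -> (0 <= b)%E ->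
  (a / b)%E = 1%E -> b != 0%E /\ b != +oo%E.
Proof.
move=> a0 b0 ab1; split; apply/eqP => bE; move: ab1; rewrite bE.
  rewrite inve0; have [->|an0] := eqVneq a 0%E.
    by rewrite mul0e => -[/eqP]; rewrite eq_sym oner_eq0.
  by rewrite gt0_muley// lt_def an0.
by rewrite invey mule0 => -[/eqP]; rewrite eq_sym oner_eq0.
Qed.

(** * Measures on the line determined by half-lines *)

Section rays.
Context {R : realType}.

Definition ray : set (set R) := [set A | exists x, A = `]-oo, x]%classic].

Lemma measurable_rayE : @measurable _ R = <<s ray >>.
Proof.
apply/seteqP; split; last first.
  apply: smallest_sub; first exact: sigma_algebra_measurable.
  by move=> _ [x ->]; exact: measurable_itv.
rewrite [X in X `<=` _](RGenOInfty.measurableE R).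
apply: smallest_sub; first exact: smallest_sigma_algebra.
move=> _ [x ->]; rewrite -setCitvl.
apply: (@measurableC _ (g_sigma_algebraType ray)).
by apply: sub_sigma_algebra; exists x.
Qed.

(** Suited to measures carried by the nonnegative half-line, such as [leb_abs], for which these rays
    have finite mass. *)
Lemma ray_measure_unique (m1 m2 : {measure set R -> \bar R}) :
  (forall x, m1 `]-oo, x]%classic = m2 `]-oo, x]%classic) ->
  (forall x, (m1 `]-oo, x]%classic < +oo)%E) ->
  forall A, measurable A -> m1 A = m2 A.
Proof.
move=> m12 m1oo.
apply: (measure_unique ray (fun k => `]-oo, k%:R]%classic) measurable_rayE).
- move=> _ _ [x ->] [y ->]; exists (Num.min x y).
  by apply/seteqP; split=> z /=; rewrite !in_itv/= le_min => /andP.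
- by move=> k; exists k%:R.
- apply/seteqP; split=> // x _; exists (Num.bound `|x|) => //=.
  rewrite in_itv/=; apply: le_trans (ler_norm x) _.
  by rewrite ltW// archi_boundP.
- by move=> _ [x ->].
- by [].
Qed.

Lemma measurable_abs : measurable_fun setT (fun x : R => `|x|).
Proof. exact: (@normr_measurable R setT). Qed.

(** Twice the Lebesgue measure of the nonnegative half-line. It appears because only |xi| enters the
    limit vector. *)
Definition leb_abs : {measure set R -> \bar R} :=
  image_measure (@lebesgue_measure R) measurable_abs.

Lemma leb_abs_ray (s : R) :
  leb_abs `]-oo, s]%classic = (2 * Num.max 0 s)%:E.
Proof.
transitivity (@lebesgue_measure R `[- s, s]%classic).
  congr (lebesgue_measure _).
  by apply/seteqP; split=> x /=; rewrite !in_itv/= ler_norml.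
rewrite lebesgue_measure_itv/= lte_fin; have [s0|s0|s0] := ltgtP 0 s.
- by rewrite gtrN// -EFinB opprK mulr_natl.
- by rewrite ltNge ltW ?mulr0// (lt_trans s0)// oppr_gt0.
- by rewrite -s0 oppr0 ltxx mulr0.
Qed.

Lemma leb_abs_sigma_finite : sigma_finite setT leb_abs.
Proof.
exists (fun k => `]-oo, k%:R]%classic).
  apply/seteqP; split=> // x _; exists (Num.bound `|x|) => //=.
  rewrite in_itv/=; apply: le_trans (ler_norm x) _.
  by rewrite ltW// archi_boundP.
by move=> k; split; [exact: measurable_itv|rewrite leb_abs_ray ltry].
Qed.

End rays.

(** * Polar coordinates for the cone measure *)

Lemma integral_mrestr d (T : measurableType d) (R : realType)
    (mu : {measure set T -> \bar R}) (D : set T) (mD : measurable D)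
    (f : T -> \bar R) :
  measurable_fun setT f -> (forall x, (0 <= f x)%E) ->
  (\int[mrestr mu mD]_x f x = \int[mu]_(x in D) f x)%E.
Proof.
move=> mf f0.
rewrite (@ge0_negligible_integral _ _ _ _ setT (~` D))//; last 2 first.
- exact: measurableC.
- by rewrite /= /mrestr setICl measure0.
rewrite setTD setCK; apply: eq_measure_integral => A mA AD.
by rewrite /= /mrestr setIidl.
Qed.

Section polar.
Context {R : realType} (q : \bar R) (n : nat).
Hypotheses (q0 : (0 < q)%E) (n0 : (0 < n)%N).
Notation N := (@pnorm R q n).
Notation W := (@Vol R 1 n).
Notation leb := (@lebesgue_measure R).

Let mN : measurable_fun setT N := @measurable_pnorm R q n.

Lemma measurable_mx1 (x : 'rV[R]_n) : measurable [set x].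
Proof.
rewrite (_ : [set x] = box (fun i j => [set x i j])).
  by apply: measurable_box => i j; exact: measurable_set1.
apply/seteqP; split=> [y -> //|y /= yx].
by apply/matrixP => i j; exact: yx.
Qed.

Lemma measurable_pnorm_gt0 : measurable [set x | 0 < N x].
Proof.
rewrite (_ : mkset _ = ~` [set x | N x <= 0]).
  by apply: measurableC; exact: measurable_sublevel.
by apply/seteqP; split=> x /=; rewrite ltNge => /negP.
Qed.

Lemma measurable_pball : measurable (@pball R q n).
Proof. exact: measurable_sublevel. Qed.

(** Where the norm vanishes, the inverse is 0 by convention and so is the direction. These points
    form a null set, which the condition 0 < [N x] excludes below. *)
Definition direction (x : 'rV[R]_n) : 'rV[R]_n := (N x)^-1 *: x.

Lemma measurable_direction : measurable_fun setT direction.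
Proof.
apply: measurable_mxP => i j; under eq_fun do rewrite mxE.
apply: measurable_funM; last exact: measurable_entry.
(* Written as a power with exponent -1, the inverse is measurable on the whole line, including at
   0. *)
under eq_fun do rewrite -powR_inv1 ?pnorm_ge0//.
exact: (measurableT_comp (measurable_powR _) mN).
Qed.

Lemma Vol_pnorm0 : (W (pball q n) < +oo)%E -> W [set x | N x <= 0] = 0%E.
Proof.
move=> ball_oo; apply: Vol_cone0.
- by rewrite mul1n.
- exact: measurable_sublevel.
- by move=> x /=; rewrite pnormZ// pmulr_rle0.
- apply: le_lt_trans ball_oo; apply: le_measure; rewrite ?inE//.
  + exact: measurable_sublevel.
  + exact: measurable_pball.
  + by move=> x /= /le_trans; apply.
Qed.

(** The truncated cone over the directions in [B], without the points of norm zero. For s = 1 it is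
    the cone in [cone_measure] up to the apex. *)
Definition sector (B : set 'rV[R]_n) (s : R) : set 'rV[R]_n :=
  [set x | [/\ 0 < N x, N x <= s & B (direction x)]].

Lemma sectorE B s : sector B s =
  ([set x | 0 < N x] `&` [set x | N x <= s]) `&` direction @^-1` B.
Proof. by apply/seteqP; split=> x [] => [? ?|[]]. Qed.

Lemma measurable_sector B s : measurable B -> measurable (sector B s).
Proof.
move=> mB; rewrite sectorE; apply: measurableI.
  by apply: measurableI; [exact: measurable_pnorm_gt0|exact: measurable_sublevel].
exact: (preimage_measurable measurable_direction).
Qed.

Lemma directionZ (t : R) x : 0 < t -> direction (t *: x) = direction x.
Proof.
move=> t0; rewrite /direction pnormZ ?ltW// scalerA; congr (_ *: _).
by rewrite invfM mulrAC mulVf ?mul1r ?gt_eqF.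
Qed.

Lemma Vol_sector B (s : R) : measurable B ->
  W (sector B s) = ((Num.max 0 s ^+ n)%:E * W (sector B 1))%E.
Proof.
move=> mB; have [s0|s0] := ltP 0 s; last first.
  rewrite expr0n eqn0Ngt n0/= mul0e (_ : sector B s = set0) ?measure0//.
  apply/seteqP; split=> // x [x0 xs _].
  by have := lt_le_trans x0 (le_trans xs s0); rewrite ltxx.
transitivity (W ((fun x => s^-1 *: x) @^-1` sector B 1)).
  congr (W _); apply/funext => x; rewrite /sector/= directionZ ?invr_gt0//.
  have -> : N (s^-1 *: x) = s^-1 * N x by rewrite pnormZ// invr_ge0 ltW.
  by rewrite pmulr_rgt0 ?invr_gt0// ler_pdivrMl// mulr1.
rewrite Vol_scale ?invr_gt0//; last exact: measurable_sector.
by rewrite invrK mul1n.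
Qed.

Section cone.
Variable kappa : probability 'rV[R]_n R.
Hypothesis kappaE : forall A, measurable A -> kappa A = cone_measure q n A.
Let omega := W (pball q n).

Let cone (A : set 'rV[R]_n) := [set x : 'rV[R]_n | exists (s : R) a,
  [/\ 0 <= s <= 1, (A `&` psphere q n) a & x = s *: a]%R].

(** The parameter s = 0 adds the origin as soon as [A] meets the sphere and adds nothing otherwise;
    [F] records the case. *)
Let coneE A : exists2 F, F = set0 \/ F = [set 0] & cone A = sector A 1 `|` F.
Proof.
have sub : cone A `<=` sector A 1 `|` [set 0].
  move=> _ [s [a [/andP[s0 s1] [Aa /= Na] ->]]].
  have [->|sn0] := eqVneq s 0; first by right; rewrite /= scale0r.
  have {}s0 : 0 < s by rewrite lt_def sn0.
  left; split; rewrite ?directionZ// ?pnormZ ?Na ?mulr1// ?ltW//.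
  by rewrite /direction Na invr1 scale1r.
have sup : sector A 1 `<=` cone A.
  move=> x [Nx0 Nx1 Ax]; exists (N x), (direction x); split.
  - by rewrite ltW.
  - split=> //=; rewrite /psphere/= /direction pnormZ ?invr_ge0 ?ltW//.
    by rewrite mulVf// gt_eqF.
  - by rewrite /direction scalerA mulfV ?scale1r// gt_eqF.
have [c0|c0] := pselect (cone A 0).
  exists [set 0]; first by right.
  apply/seteqP; split=> // x [/sup//|/= -> //].
exists set0; first by left.
rewrite setU0; apply/seteqP; split=> // x Cx.
by have [//|/= x0] := sub _ Cx; rewrite x0 in Cx.
Qed.

(** The quotient defining the cone measure equals 1 on the whole space because [kappa] is a
    probability, so [ediv_eq1] applies. *)
Lemma pball_Vol_neq0 : omega != 0%E /\ omega != +oo%E.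
Proof.
have := kappaE measurableT; rewrite probability_setT.
move/esym; rewrite /cone_measure (vol_rowE measurable_pball).
have [F Fcase cE] := coneE setT.
apply: ediv_eq1 => //; rewrite -/(cone _) vol_rowE ?cE//.
apply: measurableU; first exact: measurable_sector.
by case: Fcase => ->//; exact: measurable_mx1.
Qed.

Let w := fine omega.

Lemma omegaE : omega = w%:E.
Proof.
have [h0 hoo] := pball_Vol_neq0.
by rewrite /w fineK// ge0_fin_numE ?measure_ge0// ltey.
Qed.

Lemma w_gt0 : 0 < w.
Proof.
have [h0 hoo] := pball_Vol_neq0; rewrite -lte_fin -omegaE.
by rewrite lt_def h0 measure_ge0.
Qed.

Lemma omega_ltoo : (omega < +oo)%E.
Proof. by rewrite omegaE ltry. Qed.

Lemma kappa_sector A : measurable A -> W (sector A 1) = (w%:E * kappa A)%E.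
Proof.
move=> mA.
have W0 : W [set 0] = 0%E.
  apply/eqP; rewrite eq_le measure_ge0 andbT -(Vol_pnorm0 omega_ltoo).
  apply: le_measure; rewrite ?inE//.
  - exact: measurable_mx1.
  - exact: measurable_sublevel.
  - by move=> x /= ->; rewrite -(scale0r (0 : 'rV[R]_n)) pnormZ// mul0r.
have mF F : F = set0 \/ F = [set 0 : 'rV[R]_n] -> measurable F /\ W F = 0%E.
  by move=> [] ->; split=> //; exact: measurable_mx1.
have := kappaE mA; rewrite /cone_measure -/(cone _) (vol_rowE measurable_pball).
have [F /mF[{}mF WF0] cE] := coneE A.
rewrite cE vol_rowE; last by apply: measurableU => //; exact: measurable_sector.
rewrite measureU0//; last exact: measurable_sector.
rewrite -/omega omegaE inver gt_eqF ?w_gt0// => ->.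
by rewrite muleC -muleA -EFinM mulVf ?mule1// gt_eqF// w_gt0.
Qed.

(** The first component will carry |xi|, the second Theta; the map (t, v) to t^(1/n) v inverts it
    where the norm is positive. *)
Definition polar_map (x : 'rV[R]_n) : R * 'rV[R]_n := (N x ^+ n, direction x).

Let mNn : measurable_fun setT (fun x => N x ^+ n).
Proof. exact: measurable_funX. Qed.

Lemma measurable_polar_map : measurable_fun setT polar_map.
Proof. by apply/measurable_fun_pairP; split=> //; exact: measurable_direction. Qed.

(** The 2 comes from folding the line onto a half-line in [leb_abs]; [w] is the volume of the unit
    ball. *)
Let c := 2 / w.

Let c_ge0 : 0 <= c. Proof. by rewrite divr_ge0// ltW// w_gt0. Qed.

(* The image of W under x |-> (N x ^+ n, x / N x) is, up to the factor c, the
   product of the cone measure with the image of the Lebesgue measure of R under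
   the absolute value: there is no Jacobian because Vol_sector is linear in
   N x ^+ n. *)
Lemma polar_rectangle A B : measurable A -> measurable B ->
  (c%:E * W ([set x | (0 < N x)%R] `&` polar_map @^-1` (A `*` B)) =
   leb_abs A * kappa B)%E.
Proof.
move=> mA mB.
have mD : measurable ([set x | 0 < N x] `&` direction @^-1` B).
  apply: measurableI; first exact: measurable_pnorm_gt0.
  exact: (preimage_measurable measurable_direction).
have kB0 : 0 <= fine (kappa B) by rewrite fine_ge0.
(* With [B] fixed, both sides are measures in [A], so they need only be compared on the rays, whose
   preimages are sectors. *)
pose m1 : {measure set R -> \bar R} :=
  mscale (NngNum c_ge0) (image_measure (mrestr W mD) mNn).
pose m2 : {measure set R -> \bar R} := mscale (NngNum kB0) leb_abs.
have m1E C : m1 C = (c%:E * W (((fun x => (N x ^+ n)%R) @^-1` C) `&`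
  ([set x | (0 < N x)%R] `&` direction @^-1` B)))%E by [].
have kBE : kappa B = (fine (kappa B))%:E by rewrite fineK// fin_num_measure.
have m2E C : m2 C = (kappa B * leb_abs C)%E by rewrite kBE.
have m12 x : m1 `]-oo, x]%classic = m2 `]-oo, x]%classic.
  rewrite m1E m2E leb_abs_ray.
  have [x0|x0] := ltP 0 x; last first.
    rewrite mulr0 mule0 (_ : _ `&` _ = set0) ?measure0 ?mule0//.
    apply/seteqP; split=> // v [/=]; rewrite in_itv/= => vx [v0 _].
    by have := lt_le_trans (exprn_gt0 n v0) (le_trans vx x0); rewrite ltxx.
  have t0 : 0 < x `^ n%:R^-1 by rewrite powR_gt0.
  have tn : (x `^ n%:R^-1) ^+ n = x.
    by rewrite -powR_mulrn ?ltW// -powRrM mulVf ?powRr1 ?ltW// pnatr_eq0 -lt0n.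
  rewrite (_ : _ `&` _ = sector B (x `^ n%:R^-1)).
    rewrite Vol_sector// max_r ?ltW// tn kappa_sector// kBE -!EFinM /c.
    by congr EFin; field; rewrite gt_eqF// w_gt0.
  have Nx v : (N v ^+ n <= x) = (N v <= x `^ n%:R^-1).
    by rewrite -{1}tn ler_pXn2r// nnegrE ?pnorm_ge0// ltW.
  apply/seteqP; split=> v /=; rewrite in_itv/= Nx.
    by move=> [vx [v0 Bv]]; split.
  by move=> [v0 vx Bv].
rewrite [RHS]muleC -m2E -(ray_measure_unique m12)//.
  rewrite m1E; congr (_ * W _)%E.
  apply/seteqP; split=> v /=; first by move=> [v0 [vA vB]].
  by move=> [vA [v0 vB]].
by move=> x; rewrite m12 m2E leb_abs_ray kBE -EFinM ltry.
Qed.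

(** Uniqueness of the product measure extends [polar_rectangle] to all measurable sets; Tonelli then
    splits the integral over the product. *)
Lemma integral_polar (H : R * 'rV[R]_n -> \bar R) :
  measurable_fun setT H -> (forall z, (0 <= H z)%E) ->
  (\int[leb]_t \int[kappa]_v H (`|t|%R, v) =
   c%:E * \int[W]_(x in [set x | (0 < N x)%R]) H (polar_map x))%E.
Proof.
move=> mH H0.
pose la := to_sigma_finite (@leb_abs_sigma_finite R).
pose m' : {measure set (R * 'rV[R]_n) -> \bar R} :=
  mscale (NngNum c_ge0)
    (image_measure (mrestr W measurable_pnorm_gt0) measurable_polar_map).
have laE D : measurable D -> (la \x kappa)%E D = m' D.
  move=> mD; apply: product_measure_unique => // A B mA mB.
  by rewrite -polar_rectangle// setIC.
transitivity (\int[(la \x kappa)%E]_z H z)%E.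
  rewrite fubini_tonelli1// /fubini_F.
  pose h t := (\int[kappa]_v H (t, v))%E.
  rewrite -(@integral_image _ _ _ _ _ leb _ (@measurable_abs R) h)//.
  - exact: measurable_fun_fubini_tonelli_F.
  - by move=> t; exact: integral_ge0.
rewrite (eq_measure_integral m'); last by move=> D mD _; exact: laE.
rewrite /m' ge0_integral_mscale//; congr (_ * _)%E.
rewrite integral_image//.
by rewrite integral_mrestr//; exact: (measurableT_comp mH measurable_polar_map).
Qed.

End cone.
End polar.

(** * Density of a random radius times a random direction *)

Section radial_law.
Context {R : realType} (q : \bar R) (n : nat).
Hypotheses (q0 : (0 < q)%E) (n0 : (0 < n)%N).
Notation N := (@pnorm R q n).
Notation W := (@Vol R 1 n).
Notation leb := (@lebesgue_measure R).
Variable kappa : probability 'rV[R]_n R.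
Hypothesis kappaE : forall A, measurable A -> kappa A = cone_measure q n A.
Variable g : R -> R.
Hypotheses (mg : measurable_fun setT g) (g0 : forall t, 0 <= g t).
Hypothesis g_abs : forall t, g `|t| = g t.
Context d (T : measurableType d) (P : probability T R).
Variables (xi : T -> R) (Theta : T -> 'rV[R]_n).
Hypotheses (mxi : measurable_fun setT xi) (mTheta : measurable_fun setT Theta).
Hypothesis xi_law : forall A, measurable A ->
  P (xi @^-1` A) = (\int[leb]_(t in A) (g t)%:E)%E.
Hypothesis Theta_law : forall A, measurable A -> P (Theta @^-1` A) = kappa A.
Hypothesis indep : forall A B, measurable A -> measurable B ->
  P (xi @^-1` A `&` Theta @^-1` B) =
  (P (xi @^-1` A) * P (Theta @^-1` B))%E.

Let w := fine (W (pball q n)).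
Let c_ge0 : 0 <= 2 / w.
Proof. by rewrite divr_ge0// ltW// (w_gt0 q0 kappaE). Qed.

Let f (x : 'rV[R]_n) : \bar R := (g (N x ^+ n))%:E.

Let mf : measurable_fun setT f.
Proof.
apply/measurable_EFinP; apply: (measurableT_comp mg).
by apply: measurable_funX; exact: measurable_pnorm.
Qed.

Let f0 x : (0 <= f x)%E. Proof. by rewrite lee_fin. Qed.

Let mabs : measurable_fun setT (fun w => (`|xi w|, Theta w)).
Proof.
apply/measurable_fun_pairP; split=> //.
exact: (measurableT_comp (@measurable_abs R) mxi).
Qed.

Let mpolar : measurable_fun setT (@polar_map R q n).
Proof. exact: measurable_polar_map. Qed.

Let mpos : measurable [set x | 0 < N x]. Proof. exact: measurable_pnorm_gt0. Qed.

Let mu1 : {measure set (R * 'rV[R]_n) -> \bar R} := image_measure P mabs.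
Let mu2 : {measure set (R * 'rV[R]_n) -> \bar R} :=
  mscale (NngNum c_ge0)
    (image_measure (mrestr (density_measure W mf f0) mpos) mpolar).

Let mu2E D : mu2 D = ((2 / w)%:E *
  \int[W]_(x in @polar_map R q n @^-1` D `&` [set x | (0 < N x)%R]) f x)%E.
Proof. by []. Qed.

(** Independence makes the joint law of |xi| and Theta a product on rectangles. [integral_polar],
    applied to [g] cut off to the rectangle, moves it to R^n; [g] being even replaces g(|t|) by
    g(t). *)
Let mu1_rect A B : measurable A -> measurable B -> mu1 (A `*` B) = mu2 (A `*` B).
Proof.
move=> mA mB.
have mAB : measurable (A `*` B) by exact: measurableX.
rewrite mu2E setIC integral_mkcondr.
pose H := (fun z : R * 'rV[R]_n => (g z.1)%:E) \_ (A `*` B).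
have mH : measurable_fun setT H.
  apply/(measurable_restrictT _ mAB)/measurable_funTS/measurable_EFinP.
  exact: (measurableT_comp mg).
have H0 z : (0 <= H z)%E.
  by apply: erestrict_ge0 => y _; rewrite lee_fin.
transitivity ((2 / w)%:E *
    \int[W]_(x in [set x | (0 < N x)%R]) H (@polar_map R q n x))%E; last by [].
rewrite -(integral_polar q0 n0 kappaE mH H0).
transitivity (P (xi @^-1` ((fun x => `|x|) @^-1` A) `&` Theta @^-1` B)).
  by [].
have mA' : measurable ((fun x : R => `|x|) @^-1` A).
  exact: (preimage_measurable (@measurable_abs R)).
rewrite indep// xi_law// Theta_law// integral_mkcond.
rewrite -ge0_integralZr//.
- apply: eq_integral => t _; rewrite patchE.
  case: ifPn => [/set_mem At|/negP At].
    transitivity (\int[kappa]_v ((g t)%:E * (\1_B v)%:E))%E.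
      by rewrite ge0_integralZl ?integral_indic ?setIT ?lee_fin//; apply/measurable_EFinP.
    apply: eq_integral => v _; rewrite /H patchE indicE.
    case: (boolP (v \in B)) => [/set_mem Bv|/negP Bv].
      by rewrite mem_set// mule1 /= g_abs.
    rewrite mule0 memNset// => -[_ /= Bv']; apply: Bv; exact: mem_set.
  rewrite mul0e integral0_eq// => v _; rewrite /H patchE memNset// => -[At' _].
  by apply: At; exact: mem_set.
- apply/(measurable_restrictT _ mA')/measurable_funTS/measurable_EFinP.
  exact: mg.
- by move=> x _; apply: erestrict_ge0 => y _; rewrite lee_fin.
Qed.

(** The joint law of |xi| and Theta is the image under [polar_map] of the measure with this density.
    The map (t, v) to t^(1/n) v inverts [polar_map] off a null set, so pulling [B] back through both
    returns [B]. *)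
Lemma radial_law B : measurable B ->
  P [set w | B (`|xi w| `^ n%:R^-1 *: Theta w)] =
  ((2 / w)%:E * \int[W]_(x in B) (g (N x ^+ n))%:E)%E.
Proof.
move=> mB.
have mphi : measurable_fun setT
    (fun z : R * 'rV[R]_n => z.1 `^ n%:R^-1 *: z.2).
  apply: measurable_mxP => i j; under eq_fun do rewrite mxE.
  apply: measurable_funM; last exact: measurable_fun_entry.
  exact: (measurableT_comp (measurable_powR _)).
have mD := preimage_measurable mphi mB.
have -> : P [set w | B (`|xi w| `^ n%:R^-1 *: Theta w)] =
  mu1 ((fun z : R * 'rV[R]_n => z.1 `^ n%:R^-1 *: z.2) @^-1` B) by [].
rewrite (rectangle_measure_unique _ mu1_rect mD); last first.
  by rewrite [X in (X < _)%E](probability_setT P) ltry.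
rewrite mu2E; congr (_ * _)%E.
rewrite [RHS](@ge0_negligible_integral _ _ _ _ _ [set x | N x <= 0])//.
- congr (integral _ _ _); apply/seteqP; split=> x /=.
    move=> [+ x0]; rewrite /= /direction scalerA => Bx; split; last first.
      by apply/negP; rewrite -ltNge.
    move: Bx; rewrite -powR_mulrn ?ltW// -powRrM mulfV ?pnatr_eq0 -?lt0n//.
    by rewrite powRr1 ?ltW// mulfV ?scale1r// gt_eqF.
  move=> [Bx /negP]; rewrite -ltNge => x0; split=> //.
  rewrite /direction scalerA -powR_mulrn ?ltW// -powRrM mulfV ?pnatr_eq0 -?lt0n//.
  by rewrite powRr1 ?ltW// mulfV ?scale1r// gt_eqF.
- by apply: measurable_sublevel; exact: measurable_pnorm.
- exact: measurable_funTS.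
- by move=> x _; rewrite lee_fin.
- by apply: Vol_pnorm0 => //; exact: (omega_ltoo q0 kappaE).
Qed.

End radial_law.

(** * Independent pairs and the joint law of independent rows *)

Section product_independence.
Context d (T : measurableType d) (R : realType) (P : probability T R).
Context d1 (S1 : measurableType d1) d2 (S2 : measurableType d2) (k : nat).
Variables (Z1 : 'I_k -> T -> S1) (Z2 : 'I_k -> T -> S2).
Hypotheses (mZ1 : forall i, measurable_fun setT (Z1 i))
           (mZ2 : forall i, measurable_fun setT (Z2 i)).
Let Z i w := (Z1 i w, Z2 i w).
Let good (C : 'I_k -> set (S1 * S2)) : Prop :=
  P (\bigcap_i (Z i @^-1` C i)) = (\prod_(i < k) P (Z i @^-1` C i))%E.
Hypothesis rect : forall A B, (forall i, measurable (A i)) ->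
  (forall i, measurable (B i)) -> good (fun i => A i `*` B i).

Let mZ i : measurable_fun setT (Z i).
Proof. by apply/measurable_fun_pairP; split; [exact: mZ1|exact: mZ2]. Qed.

Let good_step (j : nat) (C : 'I_k -> set (S1 * S2)) :
  (forall i, measurable (C i)) ->
  (forall i : 'I_k, (j <= i)%N -> exists A B,
     [/\ measurable A, measurable B & C i = A `*` B]) -> good C.
Proof.
(* The rectangles are replaced by arbitrary sets one coordinate at a time. *)
elim: j C => [|j IH] C mC Crect.
  have /choice[A /choice[B AB]] := fun i => Crect i (leq0n _).
  rewrite (_ : C = fun i => A i `*` B i); last by apply/funext => i; have [] := AB i.
  by apply: rect => i; have [] := AB i.
have [kj|jk] := leqP k j.
  apply: IH => // i ji; have := leq_ltn_trans ji (ltn_ord i).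
  by rewrite ltnNge kj.
pose o := Ordinal jk.
pose C' E := fun i => if i == o then E else C i.
pose F := \bigcap_(i in [set i | i != o]) (Z i @^-1` C i).
have mF : measurable F.
  apply: fin_bigcap_measurable => [|i _]; first exact: finite_finset.
  exact: preimage_measurable.
pose c := (\prod_(i < k | i != o) P (Z i @^-1` C i))%E.
have c_ge0 : (0 <= c)%E by apply: prode_ge0.
have cE : c = (fine c)%:E.
  rewrite fineK// /c; elim/big_ind : _ => // [x y xf yf|i _].
    by rewrite fin_numM.
  by rewrite fin_num_measure//; exact: preimage_measurable.
have fc_ge0 : 0 <= fine c by rewrite fine_ge0.
(* Both sides are finite measures in the set at coordinate [o]: one is the law of [Z o] restricted
   to the event [F] of the other coordinates, the other is that law times the product [c] of their
   probabilities. *)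
pose m1 : {measure set (S1 * S2) -> \bar R} := image_measure (mrestr P mF) (mZ o).
pose m2 : {measure set (S1 * S2) -> \bar R} :=
  mscale (NngNum fc_ge0) (image_measure P (mZ o)).
have m1E E : m1 E = P (\bigcap_i (Z i @^-1` C' E i)).
  transitivity (P (Z o @^-1` E `&` F)); first by [].
  congr (P _); apply/seteqP; split=> x.
    move=> [xE xF] i _; rewrite /C' /=; case: eqP => [-> //|/eqP io].
    exact: (xF i io).
  move=> xC; split; first by have := xC o I; rewrite /C' /= eqxx.
  by move=> i /= io; have := xC i I; rewrite /C' /= (negbTE io).
have m2E E : m2 E = (\prod_(i < k) P (Z i @^-1` C' E i))%E.
  transitivity (c * P (Z o @^-1` E))%E; first by rewrite cE.
  rewrite (bigD1 o)//= /C' eqxx muleC; congr (_ * _)%E.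
  by apply: eq_bigr => i io; rewrite (negbTE io).
have CE : C = C' (C o) by apply/funext => i; rewrite /C'; case: eqP => [->|].
rewrite /good CE -m1E -m2E; apply: rectangle_measure_unique => //.
  rewrite m1E; apply: (@le_lt_trans _ _ 1%E); last by rewrite ltry.
  apply: probability_le1.
  apply: fin_bigcap_measurable => [|i _]; first exact: finite_finset.
  by apply: preimage_measurable => //; rewrite /C'; case: eqP.
move=> A B mA mB; rewrite m1E m2E; apply: IH => i.
  by rewrite /C'; case: eqP => // _; exact: measurableX.
rewrite /C' leq_eqVlt; case: (i =P o) => [-> _|io /orP[/eqP ji|/Crect//]].
  by exists A, B.
by case: io; exact: val_inj.
Qed.

(** The case j = k of [good_step], in which no coordinate is required to be a rectangle. *)
Lemma independent_pairs C : (forall i, measurable (C i)) ->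
  P (\bigcap_i ((fun w => (Z1 i w, Z2 i w)) @^-1` C i)) =
  (\prod_(i < k) P ((fun w => (Z1 i w, Z2 i w)) @^-1` C i))%E.
Proof.
move=> mC; apply: (good_step (j := k)) => // i ki.
by have := ltn_ord i; rewrite ltnNge ki.
Qed.

End product_independence.

Section rows_law.
Context {R : realType} (k n : nat).
Context d (T : measurableType d) (P : probability T R).
Variables (Y : 'I_k -> T -> 'rV[R]_n) (h : 'rV[R]_n -> R).
Hypotheses (mY : forall i, measurable_fun setT (Y i)).
Hypotheses (mh : measurable_fun setT h) (h0 : forall v, 0 <= h v).
Hypothesis Y_law : forall i B, measurable B ->
  P (Y i @^-1` B) = (\int[Vol 1 n]_(v in B) (h v)%:E)%E.
Hypothesis Y_indep : forall B, (forall i, measurable (B i)) ->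
  P (\bigcap_i (Y i @^-1` B i)) = (\prod_(i < k) P (Y i @^-1` B i))%E.

Definition rows_density (x : 'M[R]_(k, n)) : \bar R :=
  (\prod_(i < k) h (row i x))%:E.

Lemma measurable_rows_density : measurable_fun setT rows_density.
Proof.
apply/measurable_EFinP; apply: (@measurable_prod _ _ R) => i _.
by apply: (measurableT_comp mh); exact: measurable_row.
Qed.

Lemma rows_density_ge0 x : (0 <= rows_density x)%E.
Proof. by rewrite lee_fin prodr_ge0. Qed.

Lemma integral_rows_density (B : 'I_k -> set 'rV[R]_n) :
  (forall i, measurable (B i)) ->
  (\int[Vol k n]_(x in [set x | forall i, B i (row i x)]) rows_density x =
   \prod_(i < k) \int[Vol 1 n]_(v in B i) (h v)%:E)%E.
Proof.
move=> mB; rewrite integral_mkcond.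
transitivity (\int[Vol k n]_x (\prod_(i < k) (h (row i x) * \1_(B i) (row i x))%R)%:E)%E.
  apply: eq_integral => x _; rewrite patchE big_split/=.
  case: ifPn => [/set_mem xB|/negP xB].
    rewrite [X in (_ * X)%:E]big1 ?mulr1// => i _.
    by rewrite indicE mem_set.
  have [i iB] : exists i, ~ B i (row i x).
    by apply/existsNP => xB'; apply: xB; exact: mem_set.
  rewrite [X in (_ * X)%:E](bigD1 i)//= indicE memNset//.
  by rewrite mul0r mulr0.
rewrite (integral_prod_rows (f := fun i v => h v * \1_(B i) v)).
- apply: eq_bigr => i _; rewrite [RHS]integral_mkcond.
  apply: eq_integral => v _; rewrite patchE indicE.
  by case: ifP => _; rewrite ?mulr1 ?mulr0.
- by move=> i; apply: measurable_funM => //; exact: measurable_indic.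
- by move=> i v; rewrite mulr_ge0// indicE.
Qed.

(** Both sides are measures on matrices. A box is an intersection of one condition per row, where
    independence and [integral_rows_density] give the same product. *)
Lemma rows_law A : measurable A ->
  P [set w | A (\matrix_(i < k) Y i w)] =
  (\int[Vol k n]_(x in A) rows_density x)%E.
Proof.
have mYm : measurable_fun setT (fun w => \matrix_(i < k) Y i w).
  apply: measurable_mxP => i j; under eq_fun do rewrite mxE.
  exact: measurable_fun_entry.
have P1 B : measurable B -> (image_measure P mYm B < +oo)%E.
  move=> mB; apply: (@le_lt_trans _ _ 1%E); last by rewrite ltry.
  by apply: probability_le1; exact: preimage_measurable.
apply: (mx_measure_unique (m1 := image_measure P mYm)
  (m2 := density_measure _ measurable_rows_density rows_density_ge0)); last first.
  by move=> r; apply: P1; apply: measurable_box => i j; exact: measurable_itv.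
move=> C mC; pose B i := box (fun _ : 'I_1 => C i).
have mB i : measurable (B i) by apply: measurable_box => _ j; exact: mC.
rewrite density_measureE (_ : box C = [set x | forall i, B i (row i x)]).
  rewrite integral_rows_density//.
  under [RHS]eq_bigr => i _ do rewrite -(Y_law i)//.
  rewrite -Y_indep// image_measureE; congr (P _).
  apply/seteqP; split=> w /= wB i.
    by move=> _; have := wB i; rewrite rowK.
  by rewrite rowK; exact: wB.
apply/seteqP; split=> x xA i /=.
  by move=> a j; rewrite mxE; exact: xA.
by move=> j; have := xA i ord0 j; rewrite mxE.
Qed.

End rows_law.

(** * Marginals of the uniform distribution on the ball *)

Section marginal.
Context {R : realType} (q : \bar R) (k n : nat).
Hypotheses (q0 : (0 < q)%E) (n0 : (0 < n)%N).

(** Here [l] counts the blocks integrated out, so m = k + l and the exponent is l n / r. For p = oo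
    the weight does not depend on [l]. *)
Definition marginal_weight (p : \bar R) (l : nat) (y : 'M[R]_(k, n)) : R :=
  if p is r%:E then
    Num.max 0 (1 - bsum q r y / (k + l)%:R) `^ ((l * n)%:R / r)
  else \1_(pqball +oo%E q k n) y.

Lemma measurable_marginal_weight p l :
  measurable_fun setT (marginal_weight p l).
Proof.
have mball : measurable (@pqball R +oo%E q k n) by exact: measurable_pqball.
case: p => [r| |]; [|exact: measurable_indic..].
apply: (measurableT_comp (measurable_powR _)).
apply: measurable_maxr => //; apply: measurable_funB => //.
apply: measurable_funM => //; exact: measurable_bsum.
Qed.

Lemma marginal_weight_ge0 p l y : 0 <= marginal_weight p l y.
Proof. by case: p => [r| |] /=; rewrite ?powR_ge0// indicE. Qed.

Lemma measurable_usubmx l : measurable_fun setT (@usubmx R k l n).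
Proof.
by apply: measurable_mxP => i j; under eq_fun do rewrite mxE; exact: measurable_entry.
Qed.

Lemma Vol_usubmx l (A : set 'M[R]_(k, n)) (B : set 'M[R]_(k + l, n)) :
  measurable A -> measurable B ->
  Vol (k + l) n ([set x | A (usubmx x)] `&` B) =
  (\int[Vol k n]_(y in A) Vol l n [set z | B (col_mx y z)])%E.
Proof.
move=> mA mB; rewrite Vol_col_mx; last first.
  apply: measurableI => //.
  exact: (preimage_measurable (@measurable_usubmx l)).
rewrite [RHS]integral_mkcond; apply: eq_integral => y _.
rewrite patchE /=; case: ifPn => [/set_mem Ay|/negP Ay].
  congr (Vol l n _); apply/seteqP; split=> z; rewrite /xsection/= inE/=.
    by case.
  by rewrite col_mxKu.
rewrite (_ : xsection _ _ = set0) ?measure0//.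
apply/seteqP; split=> // z; rewrite /xsection/= inE/= col_mxKu => -[Ay' _].
by apply: Ay; exact: mem_set.
Qed.

Lemma uniform_law_setT m (B : set 'M[R]_(m, n)) :
  uniform_law B setT = 1%E -> exists2 v : R, 0 < v & vol_mx B = v%:E.
Proof.
rewrite /uniform_law setTI vol_mxE => B1.
have [v0 voo] := ediv_eq1 (measure_ge0 _ _) (measure_ge0 _ _) B1.
have vfin : Vol m n B \is a fin_num by rewrite ge0_fin_numE// ltey.
exists (fine (Vol m n B)); last by rewrite fineK.
by rewrite fine_gt0// lt_def v0 measure_ge0 ltey.
Qed.

(* In the last k blocks the section of the ball at y is a dilation of the ball by
   (1 - bsum q r y) ^ (1 / r), which gives the density up to a constant. *)
Lemma uniform_marginal p l : (0 < p)%E -> (0 < l)%N ->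
  uniform_law (pqball p q (k + l) n) setT = 1%E ->
  uniform_law (pqball p q l n) setT = 1%E ->
  exists C : R, forall A, measurable A ->
    uniform_law (pqball p q (k + l) n)
      [set x | A ((k + l)%:R `^ recip p *: usubmx x)] =
    (C%:E * \int[Vol k n]_(y in A) (marginal_weight p l y)%:E)%E.
Proof.
move=> p0 l0 /uniform_law_setT[V V0 VE] /uniform_law_setT[v v0 vE].
have invE (x : \bar R) : (x / V%:E = x * (V^-1)%:E)%E.
  by rewrite inver gt_eqF.
have kl0 : 0 < (k + l)%:R :> R by rewrite ltr0n addn_gt0 l0 orbT.
have mw A : measurable A -> measurable_fun A (fun y => (marginal_weight p l y)%:E).
  move=> mA; apply/measurable_funTS/measurable_EFinP.
  exact: measurable_marginal_weight.
move: p p0 VE vE mw => [r| |]// p0 VE vE mw.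
- have r0 : 0 < r by rewrite -lte_fin.
  set a := (k + l)%:R `^ recip r%:E.
  have aE : a = (k + l)%:R `^ r^-1 by rewrite /a /recip fine_invr.
  have a0 : 0 < a by rewrite powR_gt0.
  have ar : a `^ r = (k + l)%:R by rewrite aE -powRrM mulVf ?gt_eqF// powRr1 ?ltW.
  pose e : R := (l * n)%:R / r.
  (* The first factor undoes the dilation by a = m^(1/p) in all m n coordinates, m^e v comes from
     the sections, and V is the volume of the full ball. *)
  exists (a^-1 ^+ ((k + l) * n) * ((k + l)%:R `^ e * v) / V) => A mA.
  rewrite /uniform_law VE invE !vol_mxE.
  have mS b m : measurable [set z : 'M[R]_(m, n) | bsum q r z <= b].
    by apply: measurable_sublevel; exact: measurable_bsum.
  rewrite (_ : _ `&` _ = (fun x => a *: x) @^-1`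
    ([set x | A (usubmx x)] `&` [set x | bsum q r x <= (k + l)%:R])); last first.
    have bE x : bsum q r (a *: x) = (k + l)%:R * bsum q r x.
      by rewrite bsumZ// ?ar// ltW.
    have leE x : (bsum q r (a *: x) <= (k + l)%:R) = (bsum q r x <= 1).
      by rewrite bE -[X in (_ <= X) = _]mulr1 ler_pM2l.
    rewrite pqball_finE//; apply/seteqP; split=> x; rewrite /= leE.
      by move=> [Ax ->]; split=> //; rewrite linearZ.
    by move=> [Ax ->]; split=> //; rewrite linearZ in Ax.
  rewrite Vol_scale//; last first.
    apply: measurableI => //.
    exact: (preimage_measurable (@measurable_usubmx l)).
  rewrite Vol_usubmx//.
  rewrite vol_mxE pqball_finE// in vE.
  (* The section at y is the sublevel set at m - [bsum q r y]; its volume (m - S)_+^e v equals m^e v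
     (1 - S / m)_+^e. *)
  rewrite (eq_integral (fun y =>
    ((k + l)%:R `^ e * v)%:E * (marginal_weight r%:E l y)%:E)%E); last first.
    move=> y _.
    rewrite (_ : mkset _ = [set z | bsum q r z <= (k + l)%:R - bsum q r y]); last first.
      by apply/seteqP; split=> z /=; rewrite bsum_col_mx lerBrDl.
    rewrite Vol_sublevel ?muln_gt0 ?l0//; last by rewrite vE ltry.
    rewrite vE -!EFinM; congr EFin; rewrite mulrAC; congr (_ * _).
    rewrite /marginal_weight -/e -powRM ?(ltW kl0) ?le_max ?lexx//.
    congr (_ `^ _); rewrite maxr_pMr ?(ltW kl0)// mulr0; congr (Num.max _ _).
    by rewrite mulrBr mulr1 mulrCA mulfV ?mulr1// gt_eqF.
  rewrite ge0_integralZl//; last 3 first.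
  - exact: mw.
  - by move=> y _; rewrite lee_fin marginal_weight_ge0.
  - by rewrite lee_fin mulr_ge0 ?powR_ge0// ltW.
  by rewrite muleC !muleA -!EFinM; congr (_%:E * _)%E; ring.
(* For p = oo the scaling factor is m^0 = 1, and the section at y is the whole ball in the remaining
   blocks or empty. *)
- exists (v / V) => A mA.
  rewrite /uniform_law VE invE !vol_mxE /recip invey /= powRr0.
  under eq_set do rewrite scale1r.
  have mB m : measurable (@pqball R +oo%E q m n) by exact: measurable_pqball.
  rewrite Vol_usubmx//.
  rewrite vol_mxE in vE.
  rewrite (eq_integral (fun y => v%:E * (marginal_weight +oo%E l y)%:E)%E); last first.
    move=> y _; rewrite /marginal_weight indicE.
    case: (boolP (y \in _)) => [/set_mem yB|/negP yB].
      rewrite mule1 -vE; congr (Vol l n _); apply/seteqP; split=> z; rewrite !pqball_infE/=.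
        by move=> h i; have := h (rshift k i); rewrite rowKd.
      rewrite pqball_infE in yB => h i; case: (split_ordP i) => j ->.
        by rewrite rowKu; exact: yB.
      by rewrite rowKd.
    rewrite mule0 (_ : mkset _ = set0) ?measure0//.
    apply/seteqP; split=> // z; rewrite /= pqball_infE/= => h; apply: yB.
    by rewrite inE pqball_infE => i; have := h (lshift l i); rewrite rowKu.
  rewrite ge0_integralZl ?lee_fin ?(ltW v0)//; last 2 first.
  - exact: mw.
  - by move=> y _; rewrite lee_fin marginal_weight_ge0.
  by rewrite muleC muleA -EFinM mulrC.
Qed.

End marginal.

(** * Convergence of the marginal densities and of their normalization *)

Section marginal_limit.
Context {R : realType} (q : \bar R) (k n : nat) (r : R).
Hypotheses (q0 : (0 < q)%E) (n0 : (0 < n)%N) (r0 : 0 < r).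
Implicit Types y : 'M[R]_(k, n).
Notation S := (@bsum R q r k n).
Notation weight := (@marginal_weight R q k n r%:E).

Lemma cvg_ratio (c : R) : (l%:R / (l%:R + c)) @[l --> \oo] --> (1 : R).
Proof.
have pos : \forall l \near \oo, 0 < l%:R + c :> R.
  near=> l; rewrite -ltrBlDr sub0r; near: l.
  near=> l; apply: (@lt_le_trans _ _ (- c + 1)); first by rewrite ltrDl.
  near: l; exact: nbhs_infty_ger.
have inv0 : (l%:R + c)^-1 @[l --> \oo] --> (0 : R).
  apply/(gtr0_cvgV0 pos); apply/cvgryPge => A.
  near=> l; rewrite -lerBlDr; near: l; exact: nbhs_infty_ger.
have : (1 - c * (l%:R + c)^-1) @[l --> \oo] --> (1 - c * 0 : R).
  by apply: cvgB; [exact: cvg_cst|apply: cvgM => //; exact: cvg_cst].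
rewrite mulr0 subr0; apply: cvg_trans; apply: near_eq_cvg.
near=> l.
have lc : l%:R + c != 0 by rewrite gt_eqF//; near: l.
by field.
Unshelve. all: by end_near. Qed.

(** The inequality 1 + x <= exp x at x = - S y / (k + l), raised to a nonnegative power. *)
Lemma marginal_weight_le l y : (0 < k + l)%N ->
  weight l y <= expR (- ((l * n)%:R / r * (S y / (k + l)%:R))).
Proof.
move=> kl; rewrite /marginal_weight.
have e0 : 0 <= (l * n)%:R / r by rewrite divr_ge0 ?ler0n ?ltW.
have negE (e u : R) : - (e * u) = - u * e by ring.
rewrite [X in _ <= expR X]negE expRM ge0_ler_powR// ?nnegrE ?expR_ge0//.
  by rewrite le_max lexx.
by rewrite ge_max expR_ge0/= expR_ge1Dx.
Qed.

(** The same inequality applied to the inverse: with u = S y / (k + l), 1 / (1 - u) = 1 + u / (1 -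
    u) <= exp (u / (1 - u)). *)
Lemma marginal_weight_ge l y : S y < (k + l)%:R ->
  expR (- ((l * n)%:R / r * (S y / ((k + l)%:R - S y)))) <= weight l y.
Proof.
move=> Sm; rewrite /marginal_weight.
have e0 : 0 <= (l * n)%:R / r by rewrite divr_ge0 ?ler0n ?ltW.
have S0 : 0 <= S y by exact: bsum_ge0.
set m := (k + l)%:R in Sm *.
have m0 : 0 < m by exact: le_lt_trans Sm.
have mS : 0 < m - S y by rewrite subr_gt0.
have negE (e u : R) : - (e * u) = - u * e by ring.
rewrite [X in expR X <= _]negE expRM ge0_ler_powR// ?nnegrE ?expR_ge0//.
  by rewrite le_max lexx.
rewrite le_max; apply/orP; right.
rewrite expRN -[leRHS]invrK lef_pV2 ?posrE ?expR_gt0//; last first.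
  by rewrite invr_gt0 subr_gt0 ltr_pdivrMr// mul1r.
apply: le_trans (expR_ge1Dx _); rewrite le_eqVlt; apply/orP; left; apply/eqP.
have key (s t : R) : t != 0 -> t - s != 0 -> (1 - s / t)^-1 = 1 + s / (t - s).
  by move=> h1 h2; field; rewrite h1 h2.
by rewrite key ?gt_eqF.
Qed.

(* exp (- u / (1 - u)) <= 1 - u <= exp (- u) for u = S y / (k + l). *)
Lemma cvg_marginal_weight y :
  weight l y @[l --> \oo] --> expR (- (n%:R / r * S y)).
Proof.
(* One limit serves both bounds: the denominator is l + c with c = k above and c = k - S y below. *)
have lim (c : R) : expR (- ((l * n)%:R / r * (S y / (l%:R + c)))) @[l --> \oo]
    --> expR (- (n%:R / r * S y)).
  apply: continuous_cvg; first exact: continuous_expR.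
  apply: cvgN.
  rewrite (_ : (fun _ => _) = fun l : nat => n%:R / r * S y * (l%:R / (l%:R + c))).
    rewrite -[X in _ --> X]mulr1.
    by apply: cvgM; [exact: cvg_cst|exact: cvg_ratio].
  by apply/funext => l; rewrite natrM; ring.
apply: (squeeze_cvgr _ (lim (k%:R - S y)) (lim k%:R)).
near=> l; apply/andP; split; last first.
  rewrite -natrD addnC; apply: marginal_weight_le.
  by rewrite addn_gt0 (_ : (0 < l)%N) ?orbT//; near: l; exact: nbhs_infty_gt.
rewrite (_ : l%:R + (k%:R - S y) = (k + l)%:R - S y); last by rewrite natrD; ring.
apply: marginal_weight_ge; rewrite natrD -ltrBlDl.
near: l; exact: nbhs_infty_gtr.
Unshelve. all: by end_near. Qed.

Hypothesis fin1 :
  (\int[Vol 1 n]_v (expR (- (n%:R / r * pnorm q v `^ r)))%:E < +oo)%E.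

Lemma cvg_integral_marginal_weight A : measurable A ->
  (\int[Vol k n]_(y in A) (weight l y)%:E)%E @[l --> \oo] -->
  (\int[Vol k n]_(y in A) (expR (- (n%:R / r * S y)))%:E)%E.
Proof.
move=> mA.
have c0 : 0 < n%:R / r / 2 :> R by rewrite !divr_gt0// ltr0n.
pose G (y : 'M[R]_(k, n)) := (expR (- (n%:R / r / 2 * S y)))%:E.
have mG c : measurable_fun setT (fun y => (expR (- (c * S y)))%:E).
  apply/measurable_EFinP; apply: measurableT_comp => //.
  apply: measurableT_comp => //; apply: measurable_funM => //.
  exact: measurable_bsum.
have iG : (Vol k n).-integrable A G.
  apply: (@integrableS _ _ _ _ setT) => //.
  apply/integrableP; split; first exact: mG.
  rewrite (eq_integral G); last by move=> y _; rewrite gee0_abs// lee_fin expR_ge0.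
  by apply: (@integral_exp_bsum_ltoo _ q r (n%:R / r)) => //; rewrite divr_gt0 ?ltr0n.
(* For l > k the exponent l / (k + l) is at least 1/2, whence the bound G. *)
rewrite -(cvg_shiftn k.+1).
have [|||||_ _ //] := @dominated_convergence _ _ _ (Vol k n) A mA
  (fun l y => (weight (l + k.+1) y)%:E)
  (fun y => (expR (- (n%:R / r * S y)))%:E) G.
- move=> l; apply/measurable_funTS/measurable_EFinP.
  exact: measurable_marginal_weight.
- by apply: measurable_funTS; exact: mG.
- apply: aeW => y _; apply/cvg_EFin; first by near=> l.
  rewrite (_ : _ \o _ = fun l => weight (l + k.+1)%N y)//.
  by rewrite (cvg_shiftn k.+1 (fun l => weight l y)); exact: cvg_marginal_weight.
- exact: iG.
- apply: aeW => y l _; rewrite gee0_abs ?lee_fin ?marginal_weight_ge0//.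
  apply: le_trans (marginal_weight_le _ _) _; first by rewrite !addnS.
  rewrite ler_expR lerN2.
  set L := (l + k.+1)%N.
  have kL : (k <= L)%N by rewrite /L addnS -addSn leq_addl.
  have m0 : 0 < (k + L)%:R :> R by rewrite ltr0n /L addnS addnS.
  have -> : (L * n)%:R / r * (S y / (k + L)%:R) =
    n%:R / r * S y * (L%:R / (k + L)%:R) by rewrite natrM; ring.
  have -> : n%:R / r / 2 * S y = n%:R / r * S y * 2^-1 by ring.
  apply: ler_wpM2l; first by rewrite mulr_ge0 ?bsum_ge0// divr_ge0// ltW.
  rewrite ler_pdivlMr// ler_pdivrMl// -natrM ler_nat mul2n -addnn leq_add2r.
Unshelve. all: by end_near. Qed.

End marginal_limit.

Section normalized_limit.
Context d (T : measurableType d) (R : realType).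

(** Mass 1 determines the unknown constant as 1 / [G l setT], so [U l A] is eventually the quotient
    of [G l A] by [G l setT]. The limit is normalized in the same way: K is the inverse of
    [G' setT]. *)
Lemma cvg_normalized (U G : nat -> set T -> \bar R) (G' nu : set T -> \bar R)
    (K : R) :
  (\forall l \near \oo, exists C : R, forall A, measurable A ->
    U l A = (C%:E * G l A)%E) ->
  (\forall l \near \oo, U l setT = 1%E) ->
  (forall A, measurable A -> G l A @[l --> \oo] --> G' A) ->
  (forall A, measurable A -> nu A = (K%:E * G' A)%E) ->
  nu setT = 1%E -> (forall A, measurable A -> nu A \is a fin_num) ->
  forall A, measurable A -> U l A @[l --> \oo] --> nu A.
Proof.
move=> UG U1 GG' nuE nu1 nufin A mA.
have K0 : K != 0.
  apply/eqP => K0; move: nu1; rewrite nuE// K0 mul0e => -[/eqP].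
  by rewrite eq_sym oner_eq0.
have G'E B : measurable B -> G' B = (K^-1%:E * nu B)%E.
  by move=> mB; rewrite nuE// muleA -EFinM mulVf// mul1e.
have G'fin B : measurable B -> G' B \is a fin_num.
  by move=> mB; rewrite G'E// fin_numM// nufin.
have fG B : measurable B -> fine (G l B) @[l --> \oo] --> fine (G' B).
  by move=> mB; apply: fine_cvg; rewrite fineK ?G'fin//; exact: GG'.
have G'T : fine (G' setT) = K^-1 by rewrite G'E// nu1 mule1.
have lim : ((fine (G l setT))^-1 * fine (G l A))%:E @[l --> \oo] --> nu A.
  rewrite -(fineK (nufin A mA)); apply/cvg_EFin; first by near=> l.
  rewrite (_ : _ \o _ = fun l => (fine (G l setT))^-1 * fine (G l A))//.
  have -> : fine (nu A) = K * fine (G' A) by rewrite nuE// fineM ?G'fin.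
  apply: cvgM; last exact: fG.
  rewrite -[X in _ --> X]invrK; apply: cvgV; first by rewrite invr_eq0.
  by rewrite -G'T; exact: fG.
apply: cvg_trans lim; apply: near_eq_cvg; near=> l.
have [C CE] : exists C : R, forall A, measurable A -> U l A = (C%:E * G l A)%E.
  by near: l.
have Ul1 : U l setT = 1%E by near: l.
have GAfin : G l A \is a fin_num.
  by near: l; have /fine_cvgP[] : G l A @[l --> \oo] --> (fine (G' A))%:E by
    rewrite fineK ?G'fin//; exact: GG'.
have GTfin : G l setT \is a fin_num.
  by near: l; have /fine_cvgP[] : G l setT @[l --> \oo] --> (fine (G' setT))%:E by
    rewrite fineK ?G'fin//; exact: GG'.
rewrite CE// -(fineK GAfin) -EFinM /=; congr (_ * _)%:E.
move: Ul1; rewrite CE// -(fineK GTfin) -EFinM => -[CG].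
have G0 : fine (G l setT) != 0.
  by apply/eqP => G0; move: CG => /eqP; rewrite G0 mulr0 eq_sym oner_eq0.
by rewrite -[LHS]mul1r -CG -mulrA mulfV ?mulr1.
Unshelve. all: by end_near. Qed.

End normalized_limit.

(** * The Levy-Prokhorov metric *)

Section to_probability.
Context d (T : measurableType d) (R : realType).
Variables (mu : {measure set T -> \bar R}) (h : mu setT = 1%E).
Let nu : set T -> \bar R := mu.
HB.instance Definition _ := Measure.on nu.
HB.instance Definition _ := Measure_isProbability.Build d T R nu h.
Definition to_probability : probability T R := nu.
End to_probability.

Section levy_prokhorov.
Context d (S : measurableType d) (R : realType) (dist : S -> S -> R).
Implicit Types mu nu : probability S R.

(** A sample of size 0 is excluded: its weight is 0^-1 = 0, and the result would be the zero
    measure. *)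
Lemma empirical_probability m (x : 'I_m.+1 -> S) :
  exists mu : probability S R, empirical_measure x = mu.
Proof.
have m0 : 0 <= m.+1%:R^-1 :> R by rewrite invr_ge0.
(* [msum] is indexed by natural numbers; [inord] brings the index back to the ordinal type. *)
pose mu : {measure set S -> \bar R} :=
  mscale (NngNum m0) (msum (fun i => @dirac _ S (x (inord i)) R) m.+1).
have muE : empirical_measure x = mu.
  apply/funext => A; rewrite /empirical_measure.
  transitivity (m.+1%:R^-1%:E * \sum_(i < m.+1) @dirac _ S (x (inord i)) R A)%E; last by [].
  by congr (_ * _)%E; apply: eq_bigr => i _; rewrite inord_val.
have mu1 : mu setT = 1%E.
  rewrite -muE /empirical_measure.
  under eq_bigr do rewrite diracT.
  by rewrite sumEFin sumr_const card_ord -EFinM mulVf.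
by exists (to_probability mu1).
Qed.

Definition lp_admissible (mu nu : set S -> \bar R) : set R :=
  [set e : R | 0 < e /\ forall A, measurable A ->
         (mu A <= nu (enlargement dist A e) + e%:E)%E /\
         (nu A <= mu (enlargement dist A e) + e%:E)%E].

Lemma levy_prokhorov_le (mu nu : set S -> \bar R) e :
  lp_admissible mu nu e -> levy_prokhorov dist mu nu <= e.
Proof. by move=> h; apply: ge_inf => //; exists 0 => r [/ltW]. Qed.

Hypothesis measurable_enlargement :
  forall A e, measurable (enlargement dist A e).

Lemma lp_admissible1 mu nu : lp_admissible mu nu 1.
Proof.
split=> // A mA; split.
  by apply: (le_trans (probability_le1 mu mA)); rewrite leeDr.
by apply: (le_trans (probability_le1 nu mA)); rewrite leeDr.
Qed.

(** Between probability measures 1 is admissible, so the infimum is over a nonempty set and can be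
    approached. *)
Lemma levy_prokhorov_lt mu nu e : levy_prokhorov dist mu nu < e ->
  exists2 e', lp_admissible mu nu e' & e' < e.
Proof. by apply: inf_lt; exists 1; exact: lp_admissible1. Qed.

Section small_cells.
Variables (e : R) (N : nat) (D : nat -> set S).
Hypotheses (e0 : 0 < e) (mD : forall j, measurable (D j)).
Hypothesis tD : trivIset setT D.
Hypothesis D_small : forall j x y, D j x -> D j y -> dist x y < e.
Let E := ~` \big[setU/set0]_(j < N) D j.

Let mE : measurable E.
Proof. by apply: measurableC; apply: bigsetU_measurable. Qed.

(** Let [B] be the union of the cells that meet [A]. Then [A] lies in [B] and the remainder [E],
    while [B] lies in the enlargement of [A] because cells have diameter below e. Replacing mu by nu
    on [B] costs t for each of at most N cells. *)
Lemma cells_le mu nu (t : R) : 0 <= t ->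
  (forall j, (j < N)%N -> (mu (D j) <= nu (D j) + t%:E)%E) ->
  (mu E + (N%:R * t)%:E <= e%:E)%E ->
  forall A, measurable A ->
    (mu A <= nu (enlargement dist A e) + e%:E)%E.
Proof.
move=> t0 Dt Et A mA.
pose J (j : 'I_N) := `[< D j `&` A !=set0 >].
pose B := \big[setU/set0]_(j < N | J j) D j.
have mB : measurable B by apply: bigsetU_measurable.
have AB : A `<=` B `|` E.
  move=> x Ax; have [[j jN Dx]|xN] := pselect (exists2 j, (j < N)%N & D j x).
    left; rewrite /B (bigD1 (Ordinal jN))/=; first by left.
    by apply/asboolP; exists x.
  right; rewrite /E -bigcup_mkord => -[j /= jN Dx].
  by apply: xN; exists j.
have BA : B `<=` enlargement dist A e.
  move=> x; rewrite /B.
  elim/big_ind : _ => // [X Y hX hY [/hX|/hY]//|j /asboolP[a [Da Aa]] Dx].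
  by exists a => //; exact: D_small Da Dx.
have tJ : trivIset J (fun j : 'I_N => D j).
  by move=> i j _ _ Dij; apply: val_inj; exact: tD Dij.
have BE (m : probability S R) : m B = (\sum_(j < N | J j) m (D j))%E.
  by apply: measure_bigsetU_ord_cond.
have muB : (mu B <= nu B + (N%:R * t)%:E)%E.
  rewrite !BE; apply: (@le_trans _ _ (\sum_(j < N | J j) (nu (D j) + t%:E))%E).
    by apply: lee_sum => j _; exact: Dt.
  rewrite big_split/= leeD2l//.
  rewrite sumEFin lee_fin mulr_natl sumr_const ler_wpMn2l//.
  by rewrite (leq_trans (max_card _))// card_ord.
have muA : (mu A <= mu B + mu E)%E.
  apply: (@le_trans _ _ (mu (B `|` E))).
    by apply: le_measure; rewrite ?inE//; exact: measurableU.
  exact: measureU2.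
apply: (le_trans muA); apply: (@le_trans _ _ (nu B + (N%:R * t)%:E + mu E)%E).
  by rewrite leeD2r.
rewrite -addeA leeD//; last by rewrite addeC.
by apply: le_measure; rewrite ?inE.
Qed.

End small_cells.

End levy_prokhorov.

Section levy_prokhorov_convergence.
Context d (S : measurableType d) (R : realType) (dist : S -> S -> R).
Implicit Types mu nu : probability S R.
Hypothesis dist_sym : forall x y, dist x y = dist y x.
Hypothesis dist_triangle : forall x y z, dist x z <= dist x y + dist y z.
Hypothesis measurable_enlargement :
  forall A e, measurable (enlargement dist A e).
Hypothesis small_cover : forall e : R, 0 < e -> exists C : nat -> set S,
  [/\ forall j, measurable (C j),
      forall j x y, C j x -> C j y -> dist x y < e &
      \bigcup_j C j = setT].

(** The distance to [nu] is controlled by the masses of finitely many sets that depend only on [nu]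
    and e: N disjoint cells, and at index N their complement. *)
Lemma levy_prokhorov_cells nu (e : R) : 0 < e ->
  exists N (F : nat -> set S) (t : R), [/\ 0 < t, forall j, measurable (F j) &
    forall mu, (forall j, (j <= N)%N -> `|fine (mu (F j)) - fine (nu (F j))| <= t) ->
      levy_prokhorov dist mu nu <= e].
Proof.
move=> e0; have [C [mC C_small CT]] := small_cover e0.
pose D := seqDU C.
have mD j : measurable (D j).
  by apply: measurableD => //; apply: bigsetU_measurable.
have tD : trivIset setT D by exact: trivIset_seqDU.
have D_small j x y : D j x -> D j y -> dist x y < e.
  by move=> Dx Dy; exact: C_small (subset_seqDU Dx) (subset_seqDU Dy).
have e40 : 0 < e / 4 by rewrite divr_gt0.
pose E n := ~` \big[setU/set0]_(j < n) D j.
have mE n : measurable (E n).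
  by apply: measurableC; apply: bigsetU_measurable.
(* The complements [E n] decrease to the empty set because the cells cover the space, so continuity
   from above applies to [nu]. *)
have [N EN] : exists N, fine (nu (E N)) <= e / 4.
  have nuE0 : nu (E n) @[n --> \oo] --> 0%E.
    have capE : \bigcap_n E n = set0.
      apply/seteqP; split=> // x xE.
      have : (\bigcup_j C j) x by rewrite CT.
      rewrite seqDU_bigcup_eq => -[j _ Dx].
      by apply: (xE j.+1 I); rewrite big_ord_recr/=; right.
    rewrite -(measure0 nu) -capE; apply: nonincreasing_cvg_mu => //.
    - by apply: (le_lt_trans (probability_le1 nu (mE 0%N))); rewrite ltry.
    - exact: bigcapT_measurable.
    - move=> m n mn; apply/subsetPset; apply: subsetC.
      exact: subset_bigsetU.
  have /fine_cvgP[_ /cvgrPdist_le /(_ _ e40)[N _ /(_ N (leqnn N))]] := nuE0.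
  rewrite /= sub0r normrN => h; exists N; apply: le_trans h; exact: ler_norm.
(* The errors on the N cells and on the remainder add up to e / 4. With [nu (E N)] at most e / 4,
   the total stays below e. *)
pose t := e / 4 / N.+1%:R.
have t0 : 0 < t by rewrite divr_gt0.
have Nt : N.+1%:R * t = e / 4 by rewrite /t mulrC divfK.
have Nt' : N%:R * t + t = e / 4 by rewrite -Nt -natr1 mulrDl mul1r.
exists N, (fun j => if (j < N)%N then D j else E N), t; split=> //.
  by move=> j; case: ifP.
move=> mu h.
have fin (m : probability S R) A : measurable A -> m A = (fine (m A))%:E.
  by move=> mA; rewrite fineK// fin_num_measure.
have hD j : (j < N)%N -> `|fine (mu (D j)) - fine (nu (D j))| <= t.
  by move=> jN; have := h j (ltnW jN); rewrite jN.
have hE : `|fine (mu (E N)) - fine (nu (E N))| <= t.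
  by have := h N (leqnn N); rewrite ltnn.
have nuE0 : 0 <= fine (nu (E N)) by rewrite fine_ge0.
apply: levy_prokhorov_le; split=> // A mA; split.
- apply: (cells_le measurable_enlargement mD tD D_small (N := N) (ltW t0)) => //.
    move=> j /hD; rewrite (fin mu)// (fin nu)// -EFinD lee_fin.
    by rewrite ler_norml => /andP[_]; lra.
  rewrite -/(E N) (fin mu)// -EFinD lee_fin.
  by move: hE; rewrite ler_norml => /andP[_]; lra.
- apply: (cells_le measurable_enlargement mD tD D_small (N := N) (ltW t0)) => //.
    move=> j /hD; rewrite (fin mu)// (fin nu)// -EFinD lee_fin.
    by rewrite ler_norml => /andP[+ _]; lra.
  by rewrite -/(E N) (fin nu)// -EFinD lee_fin; lra.
Qed.

Lemma enlargement_comp A r s :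
  enlargement dist (enlargement dist A r) s `<=` enlargement dist A (r + s).
Proof.
move=> x [y [a Aa ay] yx]; exists a => //.
by apply: le_lt_trans (dist_triangle a y x) _; rewrite ltrD.
Qed.

Lemma empirical_measure_sub m (x y : 'I_m -> S) (A B : set S) :
  (forall i, A (x i) -> B (y i)) ->
  (empirical_measure x A <= empirical_measure y B :> \bar R)%E.
Proof.
move=> AB; rewrite /empirical_measure lee_wpmul2l ?lee_fin ?invr_ge0//.
apply: lee_sum => i _; rewrite !diracE lee_fin.
case: (boolP (x i \in A)) => [/set_mem/AB yB|_]; last exact: ler0n.
by rewrite mem_set.
Qed.

Lemma fine_empirical_measure m (x : 'I_m -> S) (A : set S) :
  fine (empirical_measure x A) = m%:R^-1 * \sum_(i < m) \1_A (x i) :> R.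
Proof. by rewrite /empirical_measure sumEFin -EFinM. Qed.

(** Moving every sample point by less than r sends the sample points in A into the r-enlargement of
    A, so e admissible for [y] makes e + r admissible for [x]. The slack h is there because the
    infimum may not be attained. *)
Lemma levy_prokhorov_empirical nu m (x y : 'I_m.+1 -> S) (r : R) : 0 < r ->
  (forall i, dist (x i) (y i) < r) ->
  levy_prokhorov dist (empirical_measure x) nu <=
  levy_prokhorov dist (empirical_measure y) nu + r.
Proof.
move=> r0 xy; apply/ler_addgt0Pr => h h0; set L := levy_prokhorov dist (empirical_measure y) nu.
pose z := L + h; have yz : L < z by rewrite ltrDl.
have [e [e0 he] ez] : exists2 e, lp_admissible dist (empirical_measure y) nu e & e < z.
  by move: yz; rewrite /L; have [mu ->] := empirical_probability R y; exact: levy_prokhorov_lt.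
apply: (@le_trans _ _ (e + r)); last by rewrite addrAC lerD2r ltW.
have mono A B : measurable B -> A `<=` B -> measurable A -> (nu A <= nu B)%E.
  by move=> mB AB mA; apply: le_measure; rewrite ?inE.
apply: levy_prokhorov_le; split; first exact: addr_gt0.
move=> A mA; split.
- apply: (@le_trans _ _ (empirical_measure y (enlargement dist A r))).
    by apply: empirical_measure_sub => i Ax; exists (x i).
  have [+ _] := he _ (measurable_enlargement A r); move=> /le_trans; apply.
  rewrite leeD ?lee_fin ?lerDl ?(ltW r0)//.
  apply: mono => //; first by rewrite addrC; exact: enlargement_comp.
- have [_] := he _ mA; move=> /le_trans; apply.
  rewrite leeD ?lee_fin ?lerDl ?(ltW r0)//.
  apply: empirical_measure_sub => i yA; apply: enlargement_comp.
  by exists (y i) => //; rewrite dist_sym.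
Qed.

(** Moving the sample by less than half of the excess over e keeps the distance above e. The
    parameter space [V] will be row vectors for radii and matrices for blocks. *)
Lemma open_levy_prokhorov nu m (V : topologicalType) (F : V -> 'I_m.+1 -> S) e :
  (forall v i r, 0 < r -> \forall v' \near v, dist (F v i) (F v' i) < r) ->
  open [set v | e < levy_prokhorov dist (empirical_measure (F v)) nu].
Proof.
move=> Fc; rewrite openE => v /= ev; rewrite /interior.
set L := levy_prokhorov _ _ _ in ev.
have r0 : 0 < (L - e) / 2 by rewrite divr_gt0// subr_gt0.
have : \forall v' \near v, forall i, dist (F v i) (F v' i) < (L - e) / 2.
  by apply: filter_forall => i; exact: Fc.
apply: filterS => v' vv' /=.
have := levy_prokhorov_empirical nu r0 vv'; rewrite -/L.
lra.
Qed.

(** A union bound: outside the N + 1 events where some test set of [levy_prokhorov_cells] has its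
    mass off by more than t, the distance is at most e. The test sets do not vary with m, so
    convergence for each fixed set suffices. *)
Lemma cvg_levy_prokhorov (dT : nat -> measure_display)
    (T : forall m, measurableType (dT m)) (P : forall m, probability (T m) R)
    (x : forall m, T m -> 'I_m -> S) nu :
  (forall m i, measurable_fun setT (fun w => x m w i)) ->
  (forall m e, measurable
    [set w | e < levy_prokhorov dist (empirical_measure (x m.+1 w)) nu]) ->
  (forall A (t : R), measurable A -> 0 < t ->
    P m [set w | t < `|fine (empirical_measure (x m w) A) - fine (nu A)|]
      @[m --> \oo] --> 0%E) ->
  cvg_in_probability P (levy_prokhorov dist)
    (fun m w => empirical_measure (x m w)) nu.
Proof.
move=> mx mLP lln e e0.
have [N [F [t [t0 mF hF]]]] := levy_prokhorov_cells nu e0.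
have mbad m j : measurable
    [set w | t < `|fine (empirical_measure (x m w) (F j)) - fine (nu (F j))|].
  rewrite (_ : mkset _ = ~` [set w |
    `|fine (empirical_measure (x m w) (F j)) - fine (nu (F j))| <= t]); last first.
    by apply/seteqP; split=> w /=; rewrite ltNge => /negP.
  apply: measurableC; apply: measurable_sublevel.
  apply: (measurableT_comp (@measurable_abs R)); apply: measurable_funB => //.
  under eq_fun do rewrite fine_empirical_measure.
  apply: measurable_funM => //; apply: measurable_sum => i.
  apply: (@measurableT_comp _ _ _ _ _ _ (\1_(F j) : S -> R)) => //.
have lim : (\sum_(j < N.+1) P m
    [set w | t < `|fine (empirical_measure (x m w) (F j)) - fine (nu (F j))|%R]%R)%E
    @[m --> \oo] --> (\sum_(j < N.+1) 0)%E.
  by apply: cvg_nnesum => j _; [apply: nearW => m; exact: measure_ge0|exact: lln].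
rewrite big1 in lim => //.
apply: (squeeze_cvge _ (cvg_cst 0%E) lim).
(* The index 0 is dropped, since the empirical measure of an empty sample is not a probability. *)
exists 1%N => // -[//|m] _ /=; rewrite measure_ge0/=.
pose B j := [set w |
  t < `|fine (empirical_measure (x m.+1 w) (F j)) - fine (nu (F j))|].
apply: (@content_subadditive _ _ _ (P m.+1) _ B).
- by move=> j _; exact: mbad.
- exact: mLP.
- rewrite -(bigcup_mkord _ B) => w /= ew; apply: contrapT => nbad; move: ew.
  apply/negP; rewrite -leNgt.
  have [mu muE] := empirical_probability R (x m.+1 w).
  rewrite muE; apply: hF => j jN; rewrite leNgt; apply/negP => bad.
  by apply: nbad; exists j => //=; rewrite /B/= muE.
Qed.

End levy_prokhorov_convergence.

(** * Euclidean distance, enlargements and covers by small sets *)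

Section euclidean.
Context {R : realType}.

(** Expands the nonnegative sum of squares of a - (p / sb) b, where p / sb is the minimizing
    coefficient. *)
Lemma sum_cauchy_schwarz n (a b : 'I_n -> R) :
  (\sum_i a i * b i) ^+ 2 <= (\sum_i a i ^+ 2) * (\sum_i b i ^+ 2).
Proof.
set p := \sum_i a i * b i; set sa := \sum_i a i ^+ 2; set sb := \sum_i b i ^+ 2.
have sb0 : 0 <= sb by apply: sumr_ge0 => i _; exact: sqr_ge0.
have [sbE|sbn] := eqVneq sb 0.
  have b0 i : b i = 0.
    apply/eqP; rewrite -sqrf_eq0; apply/eqP.
    by apply: (psumr_eq0P (P := predT) (F := fun i => b i ^+ 2)) => // j _; exact: sqr_ge0.
  rewrite sbE mulr0 /p big1 ?expr0n// => i _.
  by rewrite b0 mulr0.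
have {sbn}sb0 : 0 < sb by rewrite lt_def sbn.
have : 0 <= \sum_i (a i - p / sb * b i) ^+ 2.
  by apply: sumr_ge0 => i _; exact: sqr_ge0.
have -> : \sum_i (a i - p / sb * b i) ^+ 2 = sa - p ^+ 2 / sb.
  have expand c : \sum_i (a i - c * b i) ^+ 2 = sa - 2 * c * p + c ^+ 2 * sb.
    rewrite /sa /sb /p !mulr_sumr -sumrB -big_split/=.
    by apply: eq_bigr => i _; ring.
  by rewrite expand; field; rewrite gt_eqF.
by rewrite subr_ge0 ler_pdivrMr.
Qed.

Lemma pnorm2E n (x : 'rV[R]_n) : pnorm 2%:E x = Num.sqrt (\sum_i x 0 i ^+ 2).
Proof.
rewrite /pnorm powR12_sqrt ?sumr_ge0//.
congr (Num.sqrt _); apply: eq_bigr => i _.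
by rewrite powR_mulrn// real_normK// num_real.
Qed.

Lemma euclidean_dist_sym n (x y : 'rV[R]_n) :
  euclidean_dist x y = euclidean_dist y x.
Proof.
rewrite /euclidean_dist !pnorm2E; congr (Num.sqrt _).
by apply: eq_bigr => i _; rewrite !mxE -sqrrN opprB.
Qed.

Lemma euclidean_dist_triangle n (x y z : 'rV[R]_n) :
  euclidean_dist x z <= euclidean_dist x y + euclidean_dist y z.
Proof.
rewrite /euclidean_dist !pnorm2E.
set a := fun i => (x - y) 0 i; set b := fun i => (y - z) 0 i.
set sa := \sum_i (x - y) 0 i ^+ 2; set sb := \sum_i (y - z) 0 i ^+ 2.
have sa0 : 0 <= sa by apply: sumr_ge0 => i _; exact: sqr_ge0.
have sb0 : 0 <= sb by apply: sumr_ge0 => i _; exact: sqr_ge0.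
have r0 : 0 <= Num.sqrt sa + Num.sqrt sb by rewrite addr_ge0 ?sqrtr_ge0.
rewrite -(ger0_norm r0) -sqrtr_sqr ler_wsqrtr//.
rewrite sqrrD !sqr_sqrtr// -sqrtrM//.
have -> : \sum_i (x - z) 0 i ^+ 2 = sa + (\sum_i a i * b i) *+ 2 + sb.
  rewrite /sa /sb -mulr_natl mulr_sumr -!big_split/=; apply: eq_bigr => i _.
  by rewrite /a /b !mxE; ring.
rewrite lerD2r lerD2l lerMn2r/=.
apply: le_trans (ler_norm _) _; rewrite -sqrtr_sqr ler_wsqrtr//.
exact: sum_cauchy_schwarz.
Qed.

Lemma euclidean_dist_small n (r : R) : 0 < r -> exists2 t : R, 0 < t &
  forall x y : 'rV[R]_n, (forall j, `|x 0 j - y 0 j| < t) ->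
    euclidean_dist x y < r.
Proof.
(* With t = r / (n + 1), n t^2 < (n + 1)^2 t^2 = r^2; the successor covers n = 0. *)
move=> r0; exists (r / n.+1%:R); first by rewrite divr_gt0.
move=> x y xy; rewrite /euclidean_dist pnorm2E.
rewrite -(ger0_norm (ltW r0)) -sqrtr_sqr ltr_sqrt ?exprn_gt0//.
set t := r / n.+1%:R in xy.
have rE : r = n.+1%:R * t by rewrite /t mulrC divfK.
have t0 : 0 < t by rewrite divr_gt0.
apply: (@le_lt_trans _ _ (\sum_(i < n) t ^+ 2)).
  apply: ler_sum => i _; rewrite !mxE -real_normK ?num_real//.
  by rewrite lerXn2r ?nnegrE ?normr_ge0 ?ltW.
rewrite sumr_const card_ord -mulr_natl rE [X in _ < X]exprMn ltr_pM2r ?exprn_gt0//.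
rewrite -natrX ltr_nat (@leq_trans n.+1)//.
by rewrite -[X in (X <= _)%N]muln1 leq_mul.
Qed.

Lemma near_entries m n (x : 'M[R]_(m, n)) (t : R) : 0 < t ->
  \forall y \near x, forall i j, `|x i j - (y : 'M[R]_(m, n)) i j| < t.
Proof.
move=> t0; have : \forall y \near x, ball x t y by apply: nbhsx_ballx.
by apply: filterS => y [].
Qed.

Lemma near_euclidean_dist_row m n (x : 'M[R]_(m, n)) (i : 'I_m) (r : R) : 0 < r ->
  \forall y \near x, euclidean_dist (row i x) (row i y) < r.
Proof.
move=> r0; have [t t0 tr] := euclidean_dist_small n r0.
apply: filterS (near_entries x t0) => y xy; apply: tr => j.
by rewrite !mxE.
Qed.

(** An enlargement is a union of open balls, hence open whatever [A] is. *)
Lemma measurable_enlargement_euclidean n (A : set 'rV[R]_n) (e : R) :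
  measurable (enlargement (@euclidean_dist R n) A e).
Proof.
apply: open_measurable_mx; rewrite openE => x [a Aa ax]; rewrite /interior/=.
have r0 : 0 < e - euclidean_dist a x by rewrite subr_gt0.
have [t t0 tr] := euclidean_dist_small n r0.
apply: filterS (near_entries x t0) => y xy.
exists a; first exact: Aa.
apply: le_lt_trans (euclidean_dist_triangle a x y) _; rewrite -ltrBrDl.
by apply: tr => j; exact: xy.
Qed.

Lemma small_cover_euclidean n (e : R) : 0 < e ->
  exists C : nat -> set 'rV[R]_n,
  [/\ forall j, measurable (C j),
      forall j x y, C j x -> C j y -> euclidean_dist x y < e &
      \bigcup_j C j = setT].
Proof.
move=> e0; have [t t0 te] := euclidean_dist_small n e0.
have [k kt] : exists k, k.+1%:R^-1 < t / 2.
  have t20 : 0 < t / 2 by rewrite divr_gt0.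
  by have [k _ /(_ k (leqnn k))] := near_infty_natSinv_lt (PosNum t20); exists k.
exists (fun j => if unpickle j is Some c then rat_box (c, k) else set0); split.
- by move=> j; case: unpickle => // c; exact: measurable_rat_box.
- move=> j x y; case: unpickle => // c xc yc; apply: te => i.
  rewrite (splitr t).
  have := @ball_triangle _ _ (ratr (c 0 i) : R) (x 0 i) (y 0 i) (t / 2) (t / 2).
  apply; first by apply: ball_sym; exact: le_ball (ltW kt) _ (xc 0 i).
  exact: le_ball (ltW kt) _ (yc 0 i).
- apply/seteqP; split=> // x _; have [c xc] := rat_box_cover x k.
  by exists (pickle c) => //; rewrite pickleK.
Qed.

Lemma measurable_enlargement_norm (A : set R) (e : R) :
  measurable (enlargement (fun x y : R => `|x - y|) A e).
Proof.
apply: open_measurable; rewrite openE => x [a Aa ax]; rewrite /interior/=.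
have r0 : 0 < e - `|a - x| by rewrite subr_gt0.
have : \forall y \near x, ball x (e - `|a - x|) y by apply: nbhsx_ballx.
apply: filterS => y xy; exists a => //.
by apply: le_lt_trans (ler_distD x a y) _; rewrite -ltrBrDl.
Qed.

Lemma small_cover_norm (e : R) : 0 < e -> exists C : nat -> set R,
  [/\ forall j, measurable (C j),
      forall j x y, C j x -> C j y -> `|x - y| < e & \bigcup_j C j = setT].
Proof.
move=> e0; have e20 : 0 < e / 2 by rewrite divr_gt0.
exists (fun j => if unpickle j is Some c then ball (ratr c : R) (e / 2) else set0).
split.
- by move=> j; case: unpickle => // c; exact: measurable_ball.
- move=> j x y; case: unpickle => // c xc yc.
  rewrite (splitr e); apply: (@ball_triangle _ _ (ratr c : R)) => //.
  exact: ball_sym.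
- apply/seteqP; split=> // x _.
  have [c] := @rat_in_itvoo R _ _ (ltr_pwDr e20 (lexx x)).
  rewrite in_itv/= => /andP[q1 q2]; exists (pickle c); first by [].
  by rewrite pickleK /ball/= gtr0_norm ?subr_gt0// ltrBlDr addrC.
Qed.

End euclidean.

(** * Exchangeable blocks and the weak law of large numbers *)

Section exchangeability.
Context {R : realType} (p q : \bar R) (n : nat).
Hypothesis p0 : (0 < p)%E.

Lemma uniform_law_row_perm m (s : 'S_m) (D : set 'M[R]_(m, n)) : measurable D ->
  uniform_law (pqball p q m n) (row_perm s @^-1` D) =
  uniform_law (pqball p q m n) D.
Proof.
move=> mD; rewrite /uniform_law !vol_mxE; congr (_ / _)%E.
have mB := @measurable_pqball R p q m n p0.
rewrite -[RHS](Vol_row_perm s); last exact: measurableI.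
congr (Vol m n _); apply/funext => x.
by rewrite /setI/preimage/= pqball_row_perm.
Qed.

Lemma uniform_law_rows m (D : set ('rV[R]_n * 'rV[R]_n)) (i j i' j' : 'I_m) :
  measurable D -> i != j -> i' != j' ->
  uniform_law (pqball p q m n) [set x | D (row i x, row j x)] =
  uniform_law (pqball p q m n) [set x | D (row i' x, row j' x)].
Proof.
move=> mD ij ij'.
(* The first transposition sends i' to i and moves j' to [c]; the second sends [c] to j and fixes i,
   as [c] and j differ from i. *)
pose c := tperm i' i j'.
have ci : c != i.
  rewrite /c -[X in _ != X](tpermL i' i) (inj_eq perm_inj).
  by rewrite eq_sym.
pose s := (tperm i' i * tperm c j)%g.
have si : s i' = i by rewrite permM tpermL tpermD// eq_sym.
have sj : s j' = j by rewrite permM tpermL.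
rewrite -(@uniform_law_row_perm _ s [set x | D (row i' x, row j' x)]).
  by congr (uniform_law _ _); apply/funext => x; rewrite /preimage/= !row_row_perm si sj.
apply: (@preimage_measurable _ _ _ _ (fun x => (row i' x, row j' x))) => //.
by apply/measurable_fun_pairP; split; exact: measurable_row.
Qed.

End exchangeability.

Section second_moment.
Context d (T : measurableType d) (R : realType) (P : probability T R).

Lemma integral_sum_indic I (s : seq I) (D : I -> set T) (c : R) : 0 <= c ->
  (forall i, measurable (D i)) ->
  (\int[P]_w (c * \sum_(i <- s) \1_(D i) w)%:E =
   c%:E * \sum_(i <- s) P (D i))%E.
Proof.
move=> c0 mD.
under eq_integral do rewrite EFinM.
rewrite ge0_integralZl//; last 2 first.
- by apply/measurable_EFinP; apply: measurable_sum => i; exact: measurable_indic.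
- by move=> w _; rewrite lee_fin sumr_ge0// => i _; rewrite indicE.
congr (_ * _)%E; under eq_integral do rewrite -sumEFin.
rewrite ge0_integral_sum//.
- by apply: eq_bigr => i _; rewrite integral_indic// setIT.
- by move=> i; apply/measurable_EFinP; exact: measurable_indic.
Qed.

(** Chebyshev around an arbitrary v, later the limit of p1 and not p1 itself. The square of the
    average has m + 1 diagonal pairs, of probability p1, and (m + 1) m others, of probability p2. *)
Lemma second_moment_bound m (D : 'I_m.+1 -> set T) (v t p1 p2 : R) :
  0 <= v -> 0 < t -> (forall i, measurable (D i)) ->
  (forall i, P (D i) = p1%:E) ->
  (forall i j, i != j -> P (D i `&` D j) = p2%:E) ->
  (P [set w | t < `|m.+1%:R^-1 * (\sum_i \1_(D i) w) - v|%R]%R <=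
   (t ^- 2 * (m.+1%:R^-1 * p1 + (1 - m.+1%:R^-1) * p2 - 2 * v * p1 + v ^+ 2))%:E)%E.
Proof.
move=> v0 t0 mD P1 P2.
set M := m.+1%:R^-1; pose f w : R := M * \sum_i \1_(D i) w.
have M0 : 0 <= M by rewrite invr_ge0.
have f0 w : 0 <= f w by rewrite mulr_ge0// sumr_ge0// => i _; rewrite indicE.
have mf : measurable_fun setT f.
  by apply: measurable_funM => //; apply: measurable_sum => i; exact: measurable_indic.
have MS (x : R) : M * (x *+ m.+1) = x.
  by rewrite -mulr_natl /M mulKf.
have If : (\int[P]_w (f w)%:E = p1%:E)%E.
  rewrite integral_sum_indic//; under eq_bigr do rewrite P1.
  by rewrite sumEFin -EFinM sumr_const card_ord MS.
have f2E w : f w ^+ 2 = M ^+ 2 *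
    \sum_(ij <- [seq (i, j) | i <- enum 'I_m.+1, j <- enum 'I_m.+1])
      \1_(D ij.1 `&` D ij.2) w.
  rewrite /f exprMn; congr (_ * _).
  rewrite big_allpairs expr2 mulr_suml !big_enum/=; apply: eq_bigr => i _.
  rewrite mulr_sumr big_enum/=; apply: eq_bigr => j _.
  by rewrite indicI.
have If2 : (\int[P]_w (f w ^+ 2)%:E = (M * p1 + (1 - M) * p2)%:E)%E.
  under eq_integral do rewrite f2E.
  rewrite integral_sum_indic ?sqr_ge0//; last by move=> ij; exact: measurableI.
  rewrite big_allpairs/= big_enum/=.
  have row_sum i : (\sum_(j <- enum 'I_m.+1) P (D i `&` D j) = (p1 + p2 *+ m)%:E)%E.
    rewrite big_enum/= (bigD1 i)//= setIid P1 EFinD; congr (_ + _)%E.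
    under eq_bigr => j ij do rewrite P2 1?eq_sym//.
    by rewrite sumEFin sumr_const cardC1 card_ord.
  under eq_bigr do rewrite row_sum.
  rewrite sumEFin sumr_const card_ord -EFinM expr2 -mulrA MS; congr EFin.
  have mM : m%:R = M^-1 - 1 by rewrite /M invrK -natr1 addrK.
  have Mn : M != 0 by rewrite invr_eq0.
  rewrite -mulr_natl mM; field.
  exact: Mn.
have mfv : measurable_fun setT (fun w => (f w - v) ^+ 2).
  by apply: measurable_funX; exact: measurable_funB.
(* (f - v)^2 + 2 v f = f^2 + v^2 has nonnegative terms only, so that no
   integrability is needed to integrate it term by term. *)
have key : (\int[P]_w ((f w - v) ^+ 2)%:E =
    (M * p1 + (1 - M) * p2 - 2 * v * p1 + v ^+ 2)%:E)%E.
  have v20 : 0 <= 2 * v by rewrite mulr_ge0.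
  have : (\int[P]_w (((f w - v) ^+ 2)%:E + (2 * v * f w)%:E) =
      \int[P]_w ((f w ^+ 2)%:E + (v ^+ 2)%:E))%E.
    by apply: eq_integral => w _; rewrite -!EFinD; congr EFin; ring.
  rewrite ge0_integralD//; last 4 first.
  - by move=> w _; rewrite lee_fin sqr_ge0.
  - exact/measurable_EFinP.
  - by move=> w _; rewrite lee_fin mulr_ge0.
  - by apply/measurable_EFinP; exact: measurable_funM.
  rewrite ge0_integralD//; last 3 first.
  - by move=> w _; rewrite lee_fin sqr_ge0.
  - by apply/measurable_EFinP; exact: measurable_funX.
  - by move=> w _; rewrite lee_fin sqr_ge0.
  rewrite If2 integral_cst//= probability_setT mule1.
  under [X in (_ + X)%E]eq_integral do rewrite EFinM.
  rewrite ge0_integralZl//; last 2 first.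
  - exact/measurable_EFinP.
  - by move=> w _; rewrite lee_fin.
  rewrite If -EFinM -EFinD; case: (integral _ _ _) => [r| |]//.
  move=> [rE]; congr EFin; rewrite -[LHS](addrK (2 * v * p1)) rE.
  by ring.
have mbad : measurable [set w | t < `|f w - v|].
  rewrite (_ : mkset _ = ~` [set w | `|f w - v| <= t]).
    apply: measurableC; apply: measurable_sublevel.
    by apply: (measurableT_comp (@measurable_abs R)); exact: measurable_funB.
  by apply/seteqP; split=> w /=; rewrite ltNge => /negP.
have t20 : 0 < t ^+ 2 by rewrite exprn_gt0.
rewrite EFinM -lee_pdivrMl ?invr_gt0// invrK -key.
apply: (@le_trans _ _ (\int[P]_w (t ^+ 2 * \1_[set w | t < `|f w - v|] w)%:E)%E).
  under eq_integral do rewrite EFinM.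
  rewrite ge0_integralZl ?lee_fin ?(ltW t20)//; last first.
    by apply/measurable_EFinP; exact: measurable_indic.
  by rewrite integral_indic// setIT.
apply: ge0_le_integral => //.
- by move=> w _; rewrite lee_fin mulr_ge0 ?(ltW t20)// indicE.
- by apply/measurable_EFinP; apply: measurable_funM => //; exact: measurable_indic.
- exact/measurable_EFinP.
- move=> w _; rewrite lee_fin indicE; case: (boolP (w \in _)) => [/set_mem/= h|_].
    rewrite /= mulr1 -[leRHS]real_normK ?num_real//.
    by rewrite lerXn2r ?nnegrE ?(ltW t0) ?(ltW h).
  by rewrite mulr0 sqr_ge0.
Qed.

End second_moment.

Section weak_law.
Context d (S : measurableType d) (R : realType).
Variables (dT : nat -> measure_display) (T : forall m, measurableType (dT m))
  (P : forall m, probability (T m) R).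

(** As p1 tends to v and p2 to v^2, the second moment bound tends to v^2 - 2 v^2 + v^2 = 0.
    Asymptotic independence of two blocks thus replaces independence. *)
Lemma weak_law (x : forall m, T m -> 'I_m -> S) (A : set S) (p1 p2 : nat -> R) (v t : R) :
  (forall m i, measurable_fun setT (fun w => x m w i)) ->
  measurable A -> 0 <= v -> 0 < t ->
  (\forall m \near \oo, forall i, P m [set w | A (x m w i)] = (p1 m)%:E) ->
  (\forall m \near \oo, forall i j, i != j ->
    P m ([set w | A (x m w i)] `&` [set w | A (x m w j)]) = (p2 m)%:E) ->
  p1 m @[m --> \oo] --> v -> p2 m @[m --> \oo] --> v ^+ 2 ->
  P m [set w | t < `|fine (empirical_measure (x m w) A) - v|] @[m --> \oo] --> 0%E.
Proof.
move=> mx mA v0 t0 P1 P2 p1v p2v.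
have mV : m%:R^-1 @[m --> \oo] --> (0 : R).
  rewrite -(cvg_shiftS (fun m : nat => m%:R^-1 : R)); exact: cvg_harmonic.
pose b m : R := t ^- 2 * (m%:R^-1 * p1 m + (1 - m%:R^-1) * p2 m - 2 * v * p1 m + v ^+ 2).
have b0 : b m @[m --> \oo] --> (0 : R).
  rewrite (_ : 0 = t ^- 2 * (0 * v + (1 - 0) * v ^+ 2 - 2 * v * v + v ^+ 2)); last by ring.
  apply: cvgM; first exact: cvg_cst.
  apply: cvgD; last exact: cvg_cst.
  apply: cvgB; last by apply: cvgM => //; exact: cvg_cst.
  apply: cvgD; apply: cvgM => //.
  by apply: cvgB => //; exact: cvg_cst.
have bE : (b m)%:E @[m --> \oo] --> 0%E by apply: cvg_EFin => //; near=> m.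
apply: (squeeze_cvge _ (cvg_cst 0%E) bE).
near=> m; rewrite measure_ge0/=.
have m0 : (0 < m)%N by near: m; exact: nbhs_infty_gt.
have P1m : forall i, P m [set w | A (x m w i)] = (p1 m)%:E by near: m.
have P2m : forall i j, i != j ->
    P m ([set w | A (x m w i)] `&` [set w | A (x m w j)]) = (p2 m)%:E by near: m.
move: m0 P1m P2m; clear - mx mA v0 t0.
case: m => // m _ P1 P2.
rewrite (_ : mkset _ = [set w | t <
    `|m.+1%:R^-1 * (\sum_i \1_[set w | A (x m.+1 w i)] w) - v|]); last first.
  by apply/funext => w; rewrite /mkset fine_empirical_measure.
apply: second_moment_bound => // i.
exact: (preimage_measurable (mx m.+1 i) mA).
Unshelve. all: by end_near. Qed.

End weak_law.

(** * Convergence of the marginals on every measurable set *)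

Section setwise_limit.
Context {R : realType} (p q : \bar R) (n : nat).
Hypotheses (p0 : (0 < p)%E) (q0 : (0 < q)%E) (n0 : (0 < n)%N).

Definition profile (v : 'rV[R]_n) : R :=
  if p is r%:E then expR (- (n%:R / r * pnorm q v `^ r))
  else (pnorm q v <= 1)%R%:R.

Variables (h : 'rV[R]_n -> R) (K : R).
Hypotheses (mh : measurable_fun setT h) (h0 : forall v, 0 <= h v).
Hypothesis hE : forall v, h v = K * profile v.
Hypothesis h1 : (\int[Vol 1 n]_v (h v)%:E = 1)%E.

Definition limit_law k (A : set 'M[R]_(k, n)) : \bar R :=
  (\int[Vol k n]_(x in A) rows_density h x)%E.

Lemma limit_law_setT k : limit_law [set: 'M[R]_(k, n)] = 1%E.
Proof.
rewrite /limit_law (_ : setT = [set x : 'M[R]_(k, n) | forall i, setT (row i x)]).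
  rewrite (integral_rows_density mh h0 (B := fun=> setT))//.
  by rewrite big1// => i _; exact: h1.
by apply/seteqP; split.
Qed.

Lemma limit_law_fin k (A : set 'M[R]_(k, n)) : measurable A ->
  limit_law A \is a fin_num.
Proof.
move=> mA; rewrite ge0_fin_numE; last first.
  by apply: integral_ge0 => x _; exact: rows_density_ge0.
apply: (@le_lt_trans _ _ 1%E); last by rewrite ltry.
rewrite -(limit_law_setT k); apply: ge0_subset_integral => //.
- exact: measurable_rows_density.
- by move=> x _; exact: rows_density_ge0.
Qed.

(** Both the limit of [marginal_weight] and, by [prod_profile], the product of the row profiles;
    this coincidence makes the limit rows independent. *)
Definition limit_weight k (x : 'M[R]_(k, n)) : R :=
  if p is r%:E then expR (- (n%:R / r * bsum q r x))
  else \1_(pqball +oo%E q k n) x.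

Lemma limit_weight_ge0 k (x : 'M[R]_(k, n)) : 0 <= limit_weight x.
Proof. by rewrite /limit_weight; case: p => [r| |]; rewrite ?expR_ge0 ?indicE. Qed.

Lemma measurable_limit_weight k : measurable_fun setT (@limit_weight k).
Proof.
rewrite /limit_weight; case: (p) => [r| |].
- apply: measurableT_comp => //; apply: measurableT_comp => //.
  by apply: measurable_funM => //; exact: measurable_bsum.
- by apply: measurable_indic; exact: measurable_pqball.
- by apply: measurable_indic; exact: measurable_pqball.
Qed.

Lemma prod_profile k (x : 'M[R]_(k, n)) :
  \prod_(i < k) profile (row i x) = limit_weight x.
Proof.
rewrite /profile /limit_weight; case: p p0 => [r| |]// _.
  by rewrite -expR_sum sumrN -mulr_sumr.
rewrite pqball_infE indicE.
have [xB|xB] := pselect (forall i, pnorm q (row i x) <= 1).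
  by rewrite mem_set//= big1// => i _; rewrite xB.
rewrite memNset//=; have /existsNP[i xi] := xB.
by rewrite (bigD1 i)//= (negbTE (introN idP xi)) mul0r.
Qed.

Lemma rows_densityE k (x : 'M[R]_(k, n)) :
  rows_density h x = ((K ^+ k)%:E * (limit_weight x)%:E)%E.
Proof.
rewrite /rows_density -EFinM -prod_profile; congr EFin.
under eq_bigr do rewrite hE.
by rewrite big_split/= prodr_const card_ord.
Qed.

(** Read off at the zero vector, where the profile is positive. *)
Lemma K_ge0 : 0 <= K.
Proof.
rewrite leNgt; apply/negP => K0.
have : (0 <= h 0) by []; rewrite hE /profile.
case: p p0 => [r| |]// _; rewrite nmulr_rge0//.
  by rewrite leNgt expR_gt0.
by rewrite -(scale0r (0 : 'rV[R]_n)) pnormZ// mul0r ler01/= ler10.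
Qed.

Lemma limit_lawE k (A : set 'M[R]_(k, n)) : measurable A ->
  limit_law A = ((K ^+ k)%:E * \int[Vol k n]_(x in A) (limit_weight x)%:E)%E.
Proof.
move=> mA; rewrite /limit_law.
under eq_integral do rewrite rows_densityE.
rewrite ge0_integralZl//.
- by apply/measurable_funTS/measurable_EFinP; exact: measurable_limit_weight.
- by move=> x _; rewrite lee_fin limit_weight_ge0.
- by rewrite lee_fin exprn_ge0// K_ge0.
Qed.

Hypothesis uniform1 : forall m, (0 < m)%N ->
  uniform_law (pqball p q m n) setT = 1%E.

Theorem setwise_limit k (A : set 'M[R]_(k, n)) : measurable A ->
  uniform_law (pqball p q (k + l) n)
    [set x | A ((k + l)%:R `^ recip p *: usubmx x)] @[l --> \oo] -->
  limit_law A.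
Proof.
move=> mA.
pose U l (A : set 'M[R]_(k, n)) := uniform_law (pqball p q (k + l) n)
    [set x | A ((k + l)%:R `^ recip p *: usubmx x)].
pose G l (A : set 'M[R]_(k, n)) :=
  (\int[Vol k n]_(y in A) (marginal_weight q p l y)%:E)%E.
apply: (@cvg_normalized _ _ R U G
  (fun A => \int[Vol k n]_(x in A) (limit_weight x)%:E)%E
  (@limit_law k) (K ^+ k)) => //.
- near=> l; have l0 : (0 < l)%N by near: l; exact: nbhs_infty_gt.
  by apply: uniform_marginal => //; apply: uniform1; rewrite ?addn_gt0 ?l0 ?orbT.
- near=> l; have l0 : (0 < l)%N by near: l; exact: nbhs_infty_gt.
  rewrite /U (_ : mkset _ = setT); last by apply/seteqP; split.
  by apply: uniform1; rewrite addn_gt0 l0 orbT.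
- move=> B mB; rewrite /G /limit_weight /marginal_weight.
  move: p0 h1 hE; rewrite /profile; case: (p) => [r| |]// r0 h1' hE'; last exact: cvg_cst.
  rewrite lte_fin in r0.
  apply: (@cvg_integral_marginal_weight _ q k n r) => //.
  have mexp : measurable_fun setT
      (fun v : 'rV[R]_n => (expR (- (n%:R / r * pnorm q v `^ r)))%:E).
    apply/measurable_EFinP; apply: measurableT_comp => //.
    apply: measurableT_comp => //; apply: measurable_funM => //.
    by apply: (measurableT_comp (measurable_powR r)); exact: measurable_pnorm.
  (* Mass 1 of [h] gives integrability of the profile: an infinite integral times K would be 0 or
     infinite. *)
  move: h1'; under eq_integral do rewrite hE' EFinM.
  rewrite ge0_integralZl ?lee_fin ?K_ge0//.
  move=> h1'; rewrite ltey; apply/eqP => Ioo; move: h1'; rewrite Ioo.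
  have := K_ge0; rewrite le_eqVlt => /orP[/eqP <-|K0].
    by rewrite mul0e => -[] /eqP; rewrite eq_sym oner_eq0.
  by rewrite gt0_muley.
- by move=> B; exact: limit_lawE.
- exact: limit_law_setT.
- by move=> B; exact: limit_law_fin.
Unshelve. all: by end_near. Qed.

Lemma limit_law_rows (B : 'I_2 -> set 'rV[R]_n) :
  (forall i, measurable (B i)) ->
  limit_law [set x : 'M[R]_(2, n) | forall i, B i (row i x)] =
  (\int[Vol 1 n]_(v in B ord0) (h v)%:E *
   \int[Vol 1 n]_(v in B (lift ord0 ord0)) (h v)%:E)%E.
Proof.
move=> mB; rewrite /limit_law integral_rows_density//.
by rewrite big_ord_recl big_ord1.
Qed.

End setwise_limit.

(** * From setwise convergence to expectations *)

Section setwise_expectation.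
Context {R : realType} (dT : nat -> measure_display)
  (T : forall l, measurableType (dT l)) (P : forall l, probability (T l) R)
  d' (T' : measurableType d') (P' : probability T' R)
  d (V : measurableType d).

(** The expectation is the integral over r >= 0 of the probability that g exceeds r. These tails
    converge for each r and are dominated by the indicator of [0, M]. *)
Lemma cvg_bounded_expectation (Z : forall l, T l -> V) (Z' : T' -> V)
    (g : V -> R) (M : R) :
  (forall l, measurable_fun setT (Z l)) -> measurable_fun setT Z' ->
  (forall A, measurable A -> P l (Z l @^-1` A) @[l --> \oo] --> P' (Z' @^-1` A)) ->
  measurable_fun setT g -> (forall v, 0 <= g v <= M) ->
  (\int[P l]_w (g (Z l w))%:E)%E @[l --> \oo] --> (\int[P']_w (g (Z' w))%:E)%E.
Proof.
move=> mZ mZ' PZ mg gM.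
have mgZ l : measurable_fun setT (fun w => g (Z l w)) by exact: (measurableT_comp mg).
have mgZ' : measurable_fun setT (fun w => g (Z' w)) by exact: (measurableT_comp mg).
pose X l : {RV (P l) >-> R} :=
  HB.pack (fun w => g (Z l w)) (isMeasurableFun.Build _ _ _ _ _ (mgZ l)).
pose X' : {RV P' >-> R} :=
  HB.pack (fun w => g (Z' w)) (isMeasurableFun.Build _ _ _ _ _ mgZ').
have X0 l w : 0 <= X l w by have /andP[] := gM (Z l w).
have X'0 w : 0 <= X' w by have /andP[] := gM (Z' w).
have XE l : (\int[P l]_w (g (Z l w))%:E = \int[lebesgue_measure]_(r in `[0%R, +oo[) ccdf (X l) r)%E.
  by rewrite -ge0_expectation_ccdf// expectation_def.
have X'E : (\int[P']_w (g (Z' w))%:E = \int[lebesgue_measure]_(r in `[0%R, +oo[) ccdf X' r)%E.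
  by rewrite -ge0_expectation_ccdf// expectation_def.
rewrite X'E; under eq_fun do rewrite XE.
have mray (r : R) : measurable (g @^-1` `]r, +oo[%classic).
  by apply: preimage_measurable => //; exact: measurable_itv.
have M0 : 0 <= M.
  pose w0 : T' := point; have /andP[a b] := gM (Z' w0); exact: le_trans b.
pose D := `[0, M]%classic : set R.
have mD : measurable D by exact: measurable_itv.
have [||||| _ _ //] := @dominated_convergence _ _ _ (@lebesgue_measure R)
  `[0%R, +oo[%classic (measurable_itv _) (fun l r => ccdf (X l) r) (fun r => ccdf X' r)
  (fun r => (\1_D r)%:E).
- by move=> l; apply: measurable_funTS; exact: ccdf_measurable.
- by apply: measurable_funTS; exact: ccdf_measurable.
- by apply: aeW => r _; exact: (PZ _ (mray r)).
- apply: (@integrableS _ _ _ _ setT) => //.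
  exact: integrable_indic_itv.
- apply: aeW => r l /=; rewrite in_itv/= andbT => r0.
  rewrite gee0_abs// /ccdf indicE.
  have [rM|rM] := leP r M.
    rewrite mem_set; last by rewrite /D/= in_itv/= r0.
    by apply: probability_le1; exact: measurable_itv.
  rewrite (_ : distribution _ _ _ = 0%E); first by rewrite lee_fin.
  rewrite /distribution /pushforward (_ : _ @^-1` _ = set0) ?measure0//.
  apply/seteqP; split=> // w /=; rewrite in_itv/= andbT => rX.
  have /andP[_ gM'] := gM (Z l w).
  by have := lt_trans rM (lt_le_trans rX gM'); rewrite ltxx.
Qed.

(** Adding M makes the bounded function nonnegative with bound 2 M, and the constant is subtracted
    afterwards. *)
Lemma cvg_expectation_setwise (Z : forall l, T l -> V) (Z' : T' -> V)
    (f : V -> R) (M : R) :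
  (forall l, measurable_fun setT (Z l)) -> measurable_fun setT Z' ->
  (forall A, measurable A -> P l (Z l @^-1` A) @[l --> \oo] --> P' (Z' @^-1` A)) ->
  measurable_fun setT f -> (forall v, `|f v| <= M) ->
  ('E_(P l)[fun w => f (Z l w)])%E @[l --> \oo] --> ('E_P'[fun w => f (Z' w)])%E.
Proof.
move=> mZ mZ' PZ mf fM.
have Eshift d0 (T0 : measurableType d0) (P0 : probability T0 R) (Z0 : T0 -> V) :
    measurable_fun setT Z0 ->
    ('E_P0[fun w => f (Z0 w)] = \int[P0]_w (f (Z0 w) + M)%:E - M%:E)%E.
  move=> mZ0.
  have mfZ : measurable_fun setT (fun w => f (Z0 w)) by exact: (measurableT_comp mf).
  have ifZ : P0.-integrable setT (EFin \o (fun w => f (Z0 w))).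
    apply: measurable_bounded_integrable => //.
      by rewrite [X in (X < _)%E](probability_setT P0) ltry.
    exists M; split; first exact: num_real.
    by move=> y My w _ /=; apply: le_trans (fM _) (ltW My).
  rewrite unlock; under [in RHS]eq_integral do rewrite EFinD.
  rewrite integralD//; last by apply: (@finite_measure_integrable_cst _ _ _ P0 setT M).
  by rewrite integral_cst//= probability_setT mule1 addeK.
under eq_fun do rewrite Eshift//.
rewrite Eshift//.
apply: cvgeD; [by rewrite fin_num_adde_defl| |exact: cvg_cst].
apply: (@cvg_bounded_expectation Z Z' (fun v => f v + M) (2 * M)) => //.
  exact: measurable_funD.
by move=> v; have := fM v; rewrite ler_norml => /andP[a b]; apply/andP; split; lra.
Qed.

End setwise_expectation.

(** * The p/n-Gaussian density evaluated at the n-th power of the norm *)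

Section gaussian_density.
Context {R : realType}.

Lemma pgaussian_pdf_ge0 (s : \bar R) (t : R) : 0 <= pgaussian_pdf s t.
Proof.
have G0 (a : R) : 0 <= Gamma a.
  by apply: Rintegral_ge0 => x _; rewrite mulr_ge0 ?powR_ge0 ?expR_ge0.
case: s => [r| |] /=; rewrite mulr_ge0 ?expR_ge0 ?indicE//.
by rewrite invr_ge0 !mulr_ge0 ?powR_ge0.
Qed.

Lemma measurable_pgaussian_pdf (s : \bar R) : measurable_fun setT (pgaussian_pdf s).
Proof.
case: s => [r| |] /=; apply: measurable_funM => //.
apply: measurableT_comp => //; apply: measurableT_comp => //.
apply: measurable_funM => //.
exact: (measurableT_comp (measurable_powR r) (@measurable_abs R)).
Qed.

Lemma pgaussian_pdf_abs (s : \bar R) (t : R) :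
  pgaussian_pdf s `|t| = pgaussian_pdf s t.
Proof.
have itvE : (`|t| \in `[(-1 : R), 1]%classic) = (t \in `[(-1 : R), 1]%classic).
  by apply/idP/idP; rewrite !inE/= !in_itv/= -!ler_norml normr_id.
by case: s => [r| |] /=; rewrite ?normr_id// !indicE itvE.
Qed.

(** For finite p, (N^n)^(p/n) / (p/n) = n N^p / p; for p = oo, p/n is again oo, and N^n <= 1 exactly
    when N <= 1. [K] is the normalizing factor of the Gaussian. *)
Lemma pgaussian_pdf_pnorm (p q : \bar R) n : (0 < p)%E -> (0 < n)%N ->
  exists K : R, forall v : 'rV[R]_n,
    pgaussian_pdf (p / n%:R%:E)%E (pnorm q v ^+ n) = K * profile p q v.
Proof.
move=> p0 n0; have nR : n%:R != 0 :> R by rewrite pnatr_eq0 -lt0n.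
have nR0 : 0 < n%:R :> R by rewrite ltr0n.
move: p p0 => [r| |]// p0.
- have r0 : 0 < r by rewrite -lte_fin.
  have -> : (r%:E / n%:R%:E = (r / n%:R)%:E)%E by rewrite inver (negbTE nR).
  rewrite /pgaussian_pdf /profile; set K := (_ * _ * _)^-1; exists K => v.
  congr (_ * expR (- _)).
  rewrite ger0_norm ?exprn_ge0 ?pnorm_ge0// -powR_mulrn ?pnorm_ge0// -powRrM.
  rewrite (_ : n%:R * (r / n%:R) = r); last by rewrite mulrCA mulfV ?mulr1.
  by rewrite invf_div mulrC.
- have -> : (+oo / n%:R%:E = +oo :> \bar R)%E.
    by rewrite inver (negbTE nR) gt0_mulye// lte_fin invr_gt0.
  exists 2^-1 => v; rewrite /pgaussian_pdf /profile indicE; congr (_ * _%:R).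
  have N0 := pnorm_ge0 q v.
  congr nat_of_bool; apply/idP/idP.
    rewrite inE/= in_itv/= => /andP[_]; by rewrite expr_le1.
  move=> N1; rewrite inE/= in_itv/= expr_le1// N1 andbT.
  by rewrite (le_trans _ (exprn_ge0 n N0))// lerN10.
Qed.

End gaussian_density.

(** * Limits in distribution and of empirical measures from setwise convergence *)

Lemma measurable_continuous_mx (R : realType) m n (f : 'M[R]_(m, n) -> R) :
  continuous f -> measurable_fun setT f.
Proof.
move=> /continuousP cf; apply: (measurability _ (RGenOpens.measurableE R)).
move=> _ [_ [a [b ->] <-]]; rewrite setTI; apply: open_measurable_mx.
exact/cf/interval_open.
Qed.

Unset Implicit Arguments.

Theorem theorem1 (R : realType) (p q : \bar R) (p_gt0 : (0 < p)%E)
    (q_gt0 : (0 < q)%E) (k n : nat) (k_gt0 : (0 < k)%N) (n_gt0 : (0 < n)%N)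
    (d : nat -> measure_display) (T : forall m, measurableType (d m))
    (P : forall m, probability (T m) R)
    (X : forall m, {RV (P m) >-> 'M[R]_(m, n)})
    (X_law : forall m, (0 < m)%N -> has_law (X m) (uniform_law (pqball p q m n)))
    (d' : measure_display) (T' : measurableType d') (P' : probability T' R)
    (xi : 'I_k -> {RV P' >-> R}) (Theta : 'I_k -> {RV P' >-> 'rV[R]_n})
    (xi_law : forall i, has_law (xi i) (pgaussian (p / n%:R%:E)%E))
    (Theta_law : forall i, has_law (Theta i) (cone_measure q n))
    (xi_indep : independent_family P' (fun i => xi i : T' -> R))
    (Theta_indep : independent_family P' (fun i => Theta i : T' -> 'rV[R]_n))
    (xi_Theta_indep : independent_pair P' (fun w => \row_(i < k) xi i w)
       (fun w => \matrix_(i < k) Theta i w)) :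
  (* (a), along m = k + l with l -> oo *)
  cvg_in_distribution (fun l => P (k + l)%N) P'
    (fun l w => (k + l)%:R `^ recip p *: usubmx (X (k + l)%N w))
    (fun w => \matrix_(i < k) (`|xi i w| `^ n%:R^-1 *: Theta i w))
  /\
  (* (b) *)
  cvg_in_probability P (levy_prokhorov (fun x y : R => `|x - y|))
    (fun m w => empirical_measure
       (fun i => m%:R `^ recip p * pnorm q (row i (X m w))))
    (pushforward P' (fun w => `|xi (Ordinal k_gt0) w| `^ n%:R^-1))
  /\
  cvg_in_probability P (levy_prokhorov (@euclidean_dist R n))
    (fun m w => empirical_measure
       (fun i => m%:R `^ recip p *: row i (X m w)))
    (pushforward P' (fun w => `|xi (Ordinal k_gt0) w| `^ n%:R^-1
                              *: Theta (Ordinal k_gt0) w)).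
Proof.
pose i0 := Ordinal k_gt0.
(* The law of one [Theta] makes the cone measure available as a probability; its index exists
   because 0 < k. *)
pose kappa : probability 'rV[R]_n R := distribution P' (Theta i0).
have kappaE A : measurable A -> kappa A = cone_measure q n A by exact: Theta_law.
pose s := (p / n%:R%:E)%E.
pose g := @pgaussian_pdf R s.
have mg : measurable_fun setT g by exact: measurable_pgaussian_pdf.
have g0 t : 0 <= g t by exact: pgaussian_pdf_ge0.
pose c := 2 / fine (Vol 1 n (pball q n)).
have c0 : 0 <= c by rewrite divr_ge0// ltW// (w_gt0 q_gt0 kappaE).
(* The density that [radial_law] gives to |xi_i|^(1/n) Theta_i. *)
pose h (v : 'rV[R]_n) := c * g (pnorm q v ^+ n).
have mh : measurable_fun setT h.
  apply: measurable_funM => //; apply: (measurableT_comp mg).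
  by apply: measurable_funX; exact: measurable_pnorm.
have h0 v : 0 <= h v by rewrite mulr_ge0.
have mxi i : measurable_fun setT (xi i) by [].
have mTheta i : measurable_fun setT (Theta i) by [].
pose Y (i : 'I_k) w := `|xi i w| `^ n%:R^-1 *: Theta i w.
have mY i : measurable_fun setT (Y i).
  apply: measurable_mxP => a j; under eq_fun do rewrite mxE.
  apply: measurable_funM; last exact: measurable_fun_entry.
  apply: (measurableT_comp (measurable_powR _)).
  exact: (measurableT_comp (@measurable_abs R)).
(* Independence of the two families is stated for the row of all [xi] and the matrix of all [Theta].
   Events on single coordinates are rewritten as events on these and combined with the independence
   inside each family. *)
have pair_rect (A : 'I_k -> set R) (B : 'I_k -> set 'rV[R]_n) :
    (forall i, measurable (A i)) -> (forall i, measurable (B i)) ->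
    P' ((\bigcap_i (xi i @^-1` A i)) `&` (\bigcap_i (Theta i @^-1` B i))) =
    (\prod_(i < k) (P' (xi i @^-1` A i) * P' (Theta i @^-1` B i)))%E.
  move=> mA mB; rewrite big_split/= -xi_indep// -Theta_indep//.
  have mA' : measurable [set v : 'rV[R]_k | forall i, A i (v 0 i)].
    rewrite (_ : mkset _ = box (fun _ => A)); first exact: measurable_box.
    apply/seteqP; split=> v vA i; first by rewrite (ord1 i); exact: vA.
    exact: vA.
  have mB' : measurable [set M : 'M[R]_(k, n) | forall i, B i (row i M)].
    rewrite (_ : mkset _ = \bigcap_(i in [set: 'I_k]) (row i @^-1` B i)).
      apply: fin_bigcap_measurable => [|i _]; first exact: finite_finset.
      by apply: preimage_measurable => //; exact: measurable_row.
    by apply/seteqP; split=> M MB i; [move=> _; exact: MB|exact: MB i I].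
  have AE : \bigcap_i (xi i @^-1` A i) = (fun w => \row_(i < k) xi i w) @^-1`
      [set v : 'rV[R]_k | forall i, A i (v 0 i)].
    apply/seteqP; split=> w /= wA i; first by rewrite mxE; exact: wA.
    by move=> _; have := wA i; rewrite mxE.
  have BE : \bigcap_i (Theta i @^-1` B i) = (fun w => \matrix_(i < k) Theta i w) @^-1`
      [set M : 'M[R]_(k, n) | forall i, B i (row i M)].
    apply/seteqP; split=> w /= wB i; first by rewrite rowK; exact: wB.
    by move=> _; have := wB i; rewrite rowK.
  by rewrite AE BE xi_Theta_indep.
have single i A B : measurable A -> measurable B ->
    P' (xi i @^-1` A `&` Theta i @^-1` B) =
    (P' (xi i @^-1` A) * P' (Theta i @^-1` B))%E.
  move=> mA mB.
  pose A' j := if j == i then A else setT.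
  pose B' j := if j == i then B else setT.
  have := pair_rect A' B'.
  rewrite (_ : \bigcap_i (xi i @^-1` A' i) = xi i @^-1` A); last first.
    apply/seteqP; split=> w /=; first by move=> /(_ i I); rewrite /A' eqxx.
    by move=> wA j _; rewrite /= /A'; case: eqP => // ->.
  rewrite (_ : \bigcap_i (Theta i @^-1` B' i) = Theta i @^-1` B); last first.
    apply/seteqP; split=> w /=; first by move=> /(_ i I); rewrite /B' eqxx.
    by move=> wB j _; rewrite /= /B'; case: eqP => // ->.
  move=> ->; [|by move=> j; rewrite /A'; case: eqP|by move=> j; rewrite /B'; case: eqP].
  rewrite (bigD1 i)//= big1 ?mule1; first by rewrite /A' /B' eqxx.
  move=> j ji; rewrite /A' /B' (negbTE ji) !preimage_setT.
  by rewrite probability_setT mule1.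
have Y_law i B : measurable B ->
    P' (Y i @^-1` B) = (\int[Vol 1 n]_(v in B) (h v)%:E)%E.
  move=> mB.
  have -> : P' (Y i @^-1` B) = (c%:E *
      \int[Vol 1 n]_(x in B) (g (pnorm q x ^+ n))%:E)%E.
    apply: (radial_law q_gt0 n_gt0 kappaE mg g0 _ (mxi i) (mTheta i)) => //.
    - exact: pgaussian_pdf_abs.
    - by move=> A mA; have := xi_law i A mA.
    - by move=> A mA; rewrite kappaE//; have := Theta_law i A mA.
    - exact: single.
  rewrite -ge0_integralZl//.
  - apply/measurable_funTS/measurable_EFinP; apply: (measurableT_comp mg).
    by apply: measurable_funX; exact: measurable_pnorm.
  - by move=> v _; rewrite lee_fin.
have Y_indep (B : 'I_k -> set 'rV[R]_n) : (forall i, measurable (B i)) ->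
    P' (\bigcap_i (Y i @^-1` B i)) = (\prod_(i < k) P' (Y i @^-1` B i))%E.
  move=> mB.
  have mphi : measurable_fun setT
      (fun z : R * 'rV[R]_n => `|z.1| `^ n%:R^-1 *: z.2).
    apply: measurable_mxP => a j; under eq_fun do rewrite mxE.
    apply: measurable_funM; last exact: measurable_fun_entry.
    apply: (measurableT_comp (measurable_powR _)).
    by apply: (measurableT_comp (@measurable_abs R)).
  apply: (independent_pairs mxi mTheta _
    (C := fun i => (fun z => `|z.1| `^ n%:R^-1 *: z.2) @^-1` B i)) => [A C mA mC|i].
    transitivity (P' ((\bigcap_i (xi i @^-1` A i)) `&` (\bigcap_i (Theta i @^-1` C i)))).
      congr (P' _); apply/seteqP; split=> w.
        by move=> wAC; split=> i _; have [] := wAC i I.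
      by move=> [wA wC] i _; split; [exact: (wA i I)|exact: (wC i I)].
    rewrite pair_rect//; apply: eq_bigr => i _.
    by rewrite -single.
  exact: (preimage_measurable mphi).
have [K' hK'] := @pgaussian_pdf_pnorm R p q n p_gt0 n_gt0.
have hE v : h v = c * K' * profile p q v by rewrite /h /g hK' mulrA.
have h1 : (\int[Vol 1 n]_v (h v)%:E = 1)%E.
  by rewrite -(Y_law i0)// preimage_setT probability_setT.
have uniform1 m : (0 < m)%N -> uniform_law (@pqball R p q m n) setT = 1%E.
  move=> m0; rewrite -(X_law m m0 setT measurableT).
  by rewrite /distribution /pushforward preimage_setT probability_setT.
have setwise k' (A : set 'M[R]_(k', n)) (mA : measurable A) :=
  setwise_limit p_gt0 q_gt0 n_gt0 mh h0 hE h1 uniform1 mA.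
have mX m : measurable_fun setT (X m) by [].
pose a m : R := m%:R `^ recip p.
pose x m (w : T m) i : 'rV[R]_n := a m *: row i (X m w).
have mx m i : measurable_fun setT (fun w => x m w i).
  apply: (measurableT_comp (@measurable_scale_mx R 1 n _)).
  exact: (measurableT_comp (@measurable_row R m n i) (mX m)).
pose pair (A A' : set 'rV[R]_n) (i : 'I_2) := if i == ord0 then A else A'.
(* The probability that the first two scaled blocks lie in [A] and [A'], for m = 2 + l. *)
pose u l A A' := uniform_law (pqball p q (2 + l) n)
  [set M | forall i, pair A A' i (row i (a (2 + l)%N *: usubmx M))].
have u_lim A A' : measurable A -> measurable A' ->
    u l A A' @[l --> \oo] --> (P' (Y i0 @^-1` A) * P' (Y i0 @^-1` A'))%E.
  move=> mA mA'.
  have mpair i : measurable (pair A A' i) by rewrite /pair; case: ifP.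
  rewrite !Y_law// -(limit_law_rows mh h0 mpair); apply: setwise.
  rewrite (_ : mkset _ = \bigcap_(i in [set: 'I_2]) (row i @^-1` pair A A' i)).
    apply: fin_bigcap_measurable => [|i _]; first exact: finite_finset.
    by apply: preimage_measurable => //; exact: measurable_row.
  by apply/seteqP; split=> M MB i; [move=> _; exact: MB|exact: MB i I].
(* Exchangeability carries any two distinct indices to the first two. *)
have pairE l A A' (i j : 'I_l.+2) : measurable A -> measurable A' -> i != j ->
    P l.+2 ([set w | A (x l.+2 w i)] `&` [set w | A' (x l.+2 w j)]) = u l A A'.
  move=> mA mA' ij.
  pose D : set ('rV[R]_n * 'rV[R]_n) :=
    [set z | A (a l.+2 *: z.1) /\ A' (a l.+2 *: z.2)].
  have mD : measurable D.
    apply: measurableI.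
      apply: (preimage_measurable _ mA).
      by apply: (measurableT_comp (@measurable_scale_mx R 1 n _)).
    apply: (preimage_measurable _ mA').
    by apply: (measurableT_comp (@measurable_scale_mx R 1 n _)).
  have mDrow : measurable [set M : 'M[R]_(l.+2, n) | D (row i M, row j M)].
    apply: (@preimage_measurable _ _ _ _ (fun M => (row i M, row j M))) => //.
    by apply/measurable_fun_pairP; split; exact: measurable_row.
  transitivity (uniform_law (pqball p q l.+2 n)
      [set M | D (row i M, row j M)]); first exact: X_law.
  rewrite (uniform_law_rows q p_gt0 mD ij
    (_ : lshift l (ord0 : 'I_2) != lshift l (lift ord0 ord0 : 'I_2)))//.
  rewrite /u; congr (uniform_law _ _); apply/seteqP; split=> M.
    move=> [/= AM AM'] i'; rewrite rowZ /pair; case: eqP => [->|/eqP i'0].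
      by rewrite row_usubmx.
    rewrite (_ : i' = lift ord0 ord0) ?row_usubmx//.
    by apply: val_inj; case: i' i'0 => -[|[|]].
  move=> MB; split; rewrite /=.
    by have := MB ord0; rewrite rowZ /pair eqxx row_usubmx.
  by have := MB (lift ord0 ord0); rewrite rowZ /pair /= row_usubmx.
have lln A (t : R) : measurable A -> 0 < t ->
    P m [set w | t < `|fine (empirical_measure (x m w) A) - fine (P' (Y i0 @^-1` A))|]
      @[m --> \oo] --> 0%E.
  move=> mA t0.
  have PAE : P' (Y i0 @^-1` A) = (fine (P' (Y i0 @^-1` A)))%:E.
    by rewrite fineK// fin_num_measure//; exact: preimage_measurable.
  (* [u] is indexed by the number of blocks beyond the first two, hence the shift by 2. *)
  have shift2 A' (v : R) : u l A A' @[l --> \oo] --> v%:E ->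
      fine (u (m - 2)%N A A') @[m --> \oo] --> v.
    move=> /fine_cvgP[_ uv]; rewrite -(cvg_shiftn 2).
    by under eq_fun do rewrite addnK.
  have mP m B : measurable B -> P m B = (fine (P m B))%:E.
    by move=> mB; rewrite fineK// fin_num_measure.
  apply: (@weak_law _ _ _ _ _ P x A (fun m => fine (u (m - 2)%N A setT))
    (fun m => fine (u (m - 2)%N A A))) => //.
  + exact: fine_ge0.
  + exists 2%N => // -[|[|l]] //= _ i.
    rewrite subn2/=.
    (* The probability of one block is that of a pair with no condition on a second index, which
       exists since there are at least two blocks. *)
    have [j ij] : exists j : 'I_l.+2, i != j.
      have [->|] := eqVneq i ord0; first by exists ord_max.
      by exists ord0.
    rewrite -(pairE l A setT i j mA measurableT ij).
    rewrite (_ : [set w | setT (x l.+2 w j)] = setT) ?setIT; last by apply/seteqP; split.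
    by apply: mP; exact: (preimage_measurable (mx _ i)).
  + exists 2%N => // -[|[|l]] //= _ i j ij.
    rewrite subn2/= -(pairE l A A i j mA mA ij); apply: mP.
    by apply: measurableI; exact: (preimage_measurable (mx _ _)).
  + apply: shift2; have := u_lim _ _ mA measurableT.
    by rewrite preimage_setT probability_setT mule1 -PAE.
  + apply: shift2; have := u_lim _ _ mA mA.
    by rewrite expr2 EFinM -PAE.
have P_Y1 : image_measure P' (mY i0) setT = 1%E by exact: (probability_setT P').
have mrad : measurable_fun setT (fun w => `|xi i0 w| `^ n%:R^-1).
  apply: (measurableT_comp (measurable_powR _)).
  exact: (measurableT_comp (@measurable_abs R)).
have P_rad1 : image_measure P' mrad setT = 1%E by exact: (probability_setT P').
(* An event of full probability: [cone_measure] intersects its argument with the sphere, so the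
   sphere has the same measure as the whole space. *)
pose F := [set w | pnorm q (Theta i0 w) = 1].
have mF : measurable F.
  apply: (@preimage_measurable _ _ _ _ (fun w => pnorm q (Theta i0 w)) [set 1]) => //.
  by apply: measurableT_comp => //; exact: measurable_pnorm.
have PF : P' F = 1%E.
  have mS : measurable (@psphere R q n).
    apply: (@preimage_measurable _ _ _ _ (@pnorm R q n) [set 1]) => //.
    exact: measurable_pnorm.
  rewrite -(probability_setT kappa) [RHS]kappaE//.
  transitivity (cone_measure q n (@psphere R q n)); first exact: Theta_law.
  by rewrite /cone_measure setIid setTI.
have PIF E : measurable E -> P' E = P' (E `&` F).
  move=> mE; rewrite -[in LHS](setIT E) -(setUv F) setIUr measureU.
  - rewrite [X in (_ + X)%E](_ : _ = 0%E) ?adde0//.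
    apply/eqP; rewrite eq_le measure_ge0 andbT.
    apply: (@le_trans _ _ (P' (~` F))).
      apply: le_measure; rewrite ?inE//; last exact: measurableC.
      by apply: measurableI => //; exact: measurableC.
    by rewrite probability_setC// PF subee.
  - exact: measurableI.
  - by apply: measurableI => //; exact: measurableC.
  - by rewrite setIACA setICr setI0.
(* On [F] the norm of [Y i0] is |xi|^(1/n), so the law of the radius is the image under the norm of
   the law of the block. *)
have rad_eq A : measurable A -> P' ((fun w => `|xi i0 w| `^ n%:R^-1) @^-1` A) =
    P' (Y i0 @^-1` (@pnorm R q n @^-1` A)).
  move=> mA; rewrite PIF; last exact: preimage_measurable.
  rewrite [RHS]PIF; last first.
    apply: preimage_measurable => //; apply: preimage_measurable => //.
    exact: measurable_pnorm.
  congr (P' _); apply/seteqP; split=> w [/= wA wF]; split=> //.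
    by rewrite /Y/= pnormZ ?powR_ge0// wF mulr1.
  by move: wA; rewrite /Y/= pnormZ ?powR_ge0// wF mulr1.
split; [|split].
- move=> f cf [M fM].
  apply: (@cvg_expectation_setwise _ _ _ _ _ _ _ _ _
    (fun l w => (k + l)%:R `^ recip p *: usubmx (X (k + l)%N w))
    (fun w => \matrix_(i < k) Y i w) f M) => //.
  + move=> l; apply: (measurableT_comp (@measurable_scale_mx R k n _)).
    by apply: (measurableT_comp (@measurable_usubmx R k n l)).
  + apply: measurable_mxP => i j; under eq_fun do rewrite mxE.
    exact: measurable_fun_entry.
  + move=> A mA.
    have -> : P' ((fun w => \matrix_(i < k) Y i w) @^-1` A) = limit_law h A.
      exact: (rows_law mY mh h0 Y_law Y_indep).
    apply: cvg_trans (setwise k A mA); apply: near_eq_cvg; near=> l.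
    symmetry; apply: X_law; first by rewrite addn_gt0 k_gt0.
    apply: preimage_measurable => //.
    apply: (measurableT_comp (@measurable_scale_mx R k n _)).
    exact: measurable_usubmx.
  + exact: measurable_continuous_mx.
- pose nuR : probability R R := to_probability (P_rad1 : image_measure P' mrad setT = 1%E).
  apply: (cvg_levy_prokhorov (@measurable_enlargement_norm R)
    (@small_cover_norm R) (nu := nuR) (x := fun m w i => a m * pnorm q (row i (X m w)))).
  + move=> m i; apply: measurable_funM => //.
    exact: (measurableT_comp (@measurable_pnorm_row R q m n i) (mX m)).
  + move=> m e.
    (* The event is the preimage, under the measurable map to the row of sample points, of a set
       that [open_levy_prokhorov] shows to be open. *)
    rewrite (_ : mkset _ = (fun w => \row_i (a m.+1 * pnorm q (row i (X m.+1 w))))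
      @^-1` [set v : 'rV[R]_m.+1 | e < levy_prokhorov (fun z z' : R => `|z - z'|)
        (empirical_measure (fun i => v 0 i)) nuR]); last first.
      apply/funext => w; rewrite /preimage /mkset.
      by congr (is_true (_ < levy_prokhorov _ (empirical_measure _) _));
        apply/funext => i; rewrite mxE.
    apply: preimage_measurable.
      apply: measurable_mxP => i j; under eq_fun do rewrite mxE.
      apply: measurable_funM => //.
      exact: (measurableT_comp (@measurable_pnorm_row R q m.+1 n j) (mX m.+1)).
    apply: open_measurable_mx; apply: open_levy_prokhorov => //.
    * by move=> z z'; rewrite distrC.
    * by move=> z z' z''; exact: ler_distD.
    * exact: measurable_enlargement_norm.
    * by move=> v i r r0; apply: filterS (near_entries v r0) => v' vv'; exact: vv'.
  + move=> A t mA t0.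
    have mNA : measurable (@pnorm R q n @^-1` A : set 'rV[R]_n).
      by apply: preimage_measurable => //; exact: measurable_pnorm.
    have -> : nuR A = P' (Y i0 @^-1` (@pnorm R q n @^-1` A)) by exact: rad_eq.
    (* The norm is homogeneous, so the radii fall in [A] exactly when the scaled blocks fall in its
       preimage under the norm; [lln] for blocks then applies. *)
    have empE m w : empirical_measure (fun i => a m * pnorm q (row i (X m w))) A =
        empirical_measure (x m w) (@pnorm R q n @^-1` A) :> \bar R.
      rewrite /empirical_measure; congr (_ * _)%E; apply: eq_bigr => i _.
      rewrite !diracE /x; congr (_%:R%:E); congr nat_of_bool.
      by apply/idP/idP; rewrite !inE/= pnormZ// powR_ge0.
    by under eq_fun do under eq_set do rewrite empE; exact: lln.
- pose nu : probability 'rV[R]_n R := to_probability (P_Y1 : image_measure P' (mY i0) setT = 1%E).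
  apply: (cvg_levy_prokhorov (@measurable_enlargement_euclidean R n)
    (@small_cover_euclidean R n) (nu := nu) (x := x)) => //.
  + move=> m e.
    rewrite (_ : mkset _ = (fun w => a m.+1 *: X m.+1 w)
      @^-1` [set M : 'M[R]_(m.+1, n) | e < levy_prokhorov (@euclidean_dist R n)
        (empirical_measure (fun i => row i M)) nu]); last first.
      apply/funext => w; rewrite /preimage /mkset.
      by congr (is_true (_ < levy_prokhorov _ (empirical_measure _) _));
        apply/funext => i; rewrite rowZ.
    apply: preimage_measurable.
      exact: (measurableT_comp (@measurable_scale_mx R m.+1 n _) (mX m.+1)).
    apply: open_measurable_mx; apply: open_levy_prokhorov.
    * exact: euclidean_dist_sym.
    * exact: euclidean_dist_triangle.
    * exact: measurable_enlargement_euclidean.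
    * by move=> M i r r0; exact: near_euclidean_dist_row.
Unshelve. all: by end_near. Qed.
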